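(* The Gaussian Gabor system at the critical density $$G(\varphi,\mathbb{Z}^2)=\{e^{2\pi i n t}\, e^{-\pi(t-m)^2}: (m,n)\in\mathbb{Z}^2\}$$ is a weighted lower semi frame for $L^2(\mathbb{R})$.
   Context: A countable family $\{f_k\}_{k\in K}$ in a separable Hilbert space $\mathcal{H}$ is a weighted lower semi frame for $\mathcal{H}$ if there exist a constant $C>0$ and positive real numbers $c_k$, $k\in K$, such that $C\|f\|^2\le\sum_{k\in K}|\langle f,c_k f_k\rangle|^2$ for all $f\in\mathcal{H}$ (the sum may equal $+\infty$). *)

(* Defs.v *)
From HB Require Import structures.
From mathcomp Require Import all_boot all_order all_algebra.
From mathcomp Require Import all_classical all_reals all_analysis.
From mathcomp Require Import complex.

Set Implicit Arguments.
Unset Strict Implicit.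
Unset Printing Implicit Defensive.

Import Order.TTheory GRing.Theory Num.Theory.
Import numFieldNormedType.Exports.

Local Open Scope classical_set_scope.
Local Open Scope complex_scope.
Local Open Scope ring_scope.

(* The modulus as an element of R; the norm `|z| on R[i] takes its values in
   R[i] instead. *)
Definition cmod (R : realType) (z : R[i]) : R := ComplexField.Normc.normc z.

(* R[i] carries no sigma-algebra in the libraries, so measurability and
   integration of complex-valued functions are componentwise. *)
Definition cmeasurable_fun (d : measure_display) (T : measurableType d)
    (R : realType) (f : T -> R[i]) : Prop :=
  measurable_fun setT (fun x => complex.Re (f x)) /\
  measurable_fun setT (fun x => complex.Im (f x)).

Definition cintegral (d : measure_display) (T : measurableType d)
    (R : realType) (mu : {measure set T -> \bar R}) (f : T -> R[i]) : R[i] :=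
  Rintegral mu setT (fun x => complex.Re (f x)) +i*
  Rintegral mu setT (fun x => complex.Im (f x)).

Definition L2norm (d : measure_display) (T : measurableType d)
    (R : realType) (mu : {measure set T -> \bar R}) (f : T -> R[i]) : \bar R :=
  'N[mu]_2%:E[EFin \o (@cmod R \o f)]%E.

(* Elements of the complex Hilbert space L^2(mu) are given by representatives:
   the norm and the inner product are invariant under mu-a.e. equality, so
   quantifying over representatives is the same as quantifying over classes. *)
Definition L2 (d : measure_display) (T : measurableType d)
    (R : realType) (mu : {measure set T -> \bar R}) : set (T -> R[i]) :=
  [set f | cmeasurable_fun f /\ (L2norm mu f < +oo)%E].

(* Linear in the first argument, conjugate-linear in the second. *)
Definition L2inner (d : measure_display) (T : measurableType d)
    (R : realType) (mu : {measure set T -> \bar R}) (f g : T -> R[i]) : R[i] :=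
  cintegral mu (fun x => f x * (g x)^*%C).

(* The sum is taken in the extended reals and may be +oo. *)
Definition weighted_lower_semi_frame (d : measure_display)
    (T : measurableType d) (R : realType) (mu : {measure set T -> \bar R})
    (K : countType) (F : K -> T -> R[i]) : Prop :=
  (forall k, L2 mu (F k)) /\
  exists (C : R) (c : K -> R),
    [/\ 0 < C,
        forall k, 0 < c k &
        forall f, L2 mu f ->
          (C%:E * L2norm mu f ^+ 2 <=
           \esum_(k in [set: K])
             (cmod (L2inner mu f (fun x => (c k)%:C * F k x)) ^+ 2)%:E)%E].

Definition expi (R : realType) (x : R) : R[i] := cos x +i* sin x.

Definition gaussian (R : realType) (t : R) : R[i] :=
  (expR (- pi * t ^+ 2))%:C.

(* G(g, Z^2), indexed by (m, n) : m is the translation, n the modulation. *)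
Definition gabor (R : realType) (g : R -> R[i]) (mn : int * int) (t : R) :
    R[i] :=
  expi (2 * pi * mn.2%:~R * t) * g (t - mn.1%:~R).

(* Main.v *)
Require Import Defs.
From HB Require Import structures.
From mathcomp Require Import all_boot all_order all_algebra.
From mathcomp Require Import all_classical all_reals all_analysis.
From mathcomp Require Import measurable_realfun complex ring lra zify.

(** Fix f in L^2 and put, for a modulation index n and a translation index m,
    a(m, n) for the inner product of f with the corresponding Gabor atom.  The
    weights 4 ^ (|m| + |n|) make every a(m, n) at most D * 4 ^ - (|m| + |n|) as
    soon as the right-hand side D ^ 2 is finite, so what has to be shown is that
    such a decay forces ||f|| <= C * D.  Since the weights are even in n, the
    real and the imaginary part of f can be treated separately, and f = u is
    real from here on.

    Periodizing x |-> u x * exp (- pi (x - m)^2) over the integers gives a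
    function on the unit interval whose Fourier coefficients are the a(m, n).
    They are summable, so by uniqueness of Fourier coefficients
    (fourier_uniqueness) it equals almost everywhere the sum p_m of its Fourier
    series, which is bounded by a multiple of D * 4 ^ - |m|, is Lipschitz with
    such a constant, and is periodic.  For almost every t this is a discrete
    deconvolution problem for the square-summable samples F k = u (t + k):

      p_m t = sum_k F k * exp (- pi (t + k - m)^2)     for all integers m.

    The Gaussian sequence on the right factors (kernelZ_rec) as a sequence
    dominated by its entry at 0, whose convolution is invertible on
    square-summable sequences uniformly in t (conv_dominant), times
    delta_0 + r * delta_1 with r = exp (- pi (1 - 2 t)).  The second factor
    carries the zero of the theta function: it degenerates exactly at t = 1/2,
    where r = 1.  The first order recursion that remains is solved by an energy
    estimate (recursion_bounds).  Together these say that, up to a multiple of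
    D ^ 2, the squared norm of F is comparable to S t ^ 2 / (1/2 - |t|), where
    S t is the alternating sum of the p_m t (gauss_sampling_bounds).

    This comparison is then read in both directions.  As u is in L^2, the
    squared norm of F is integrable in t, whereas 1 / (1/2 - t) is not; hence
    S (1/2) = 0.  This is where the redundancy of the system at the critical
    density by a single element shows up.  Being Lipschitz and periodic, S t is
    then at most a multiple of D * (1/2 - |t|), and the comparison bounds the
    squared norm of F by a multiple of D ^ 2 for almost every t.  Integrating
    over t gives the bound on u (real_sampling_bound). *)

Set Implicit Arguments.
Unset Strict Implicit.
Unset Printing Implicit Defensive.

Import Order.TTheory GRing.Theory Num.Theory.
Import numFieldNormedType.Exports.

Local Open Scope classical_set_scope.
Local Open Scope ring_scope.

(** * Unconditional sums of real families *)

Definition esumT {R : realType} {T : choiceType} (x : T -> R) : \bar R :=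
  (\esum_(k in [set: T]) (x k)%:E)%E.

Definition asummable {R : realType} {T : choiceType} (x : T -> R) : Prop :=
  (esumT (fun k => `|x k|)%R < +oo)%E.

(** The signed sum is the difference of the sums of the positive and negative
    parts: no enumeration of the index type is chosen, so that reindexing by a
    bijection is immediate, and each part can be exchanged with an integral by
    monotone convergence. *)
Definition rsum {R : realType} {T : choiceType} (x : T -> R) : R :=
  fine (esumT (fun k => Num.max (x k) 0)%R) -
  fine (esumT (fun k => Num.max (- x k) 0)%R).

Section AbsoluteSums.
Context {R : realType} {T : choiceType}.
Implicit Types x y a b : T -> R.

Lemma esumT_ge0 x : (forall k, 0 <= x k) -> (0 <= esumT x)%E.
Proof. by move=> x0; apply: esum_ge0 => k _; rewrite lee_fin. Qed.

Lemma le_esumT x y : (forall k, x k <= y k) -> (esumT x <= esumT y)%E.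
Proof. by move=> xy; apply: le_esum => k _; rewrite lee_fin. Qed.

Lemma eq_esumT x y : x =1 y -> esumT x = esumT y.
Proof. by move=> xy; congr esumT; exact/funext. Qed.

Lemma esumTD x y : (forall k, 0 <= x k) -> (forall k, 0 <= y k) ->
  esumT (fun k => x k + y k)%R = (esumT x + esumT y)%E.
Proof.
move=> x0 y0; rewrite /esumT -esumD//; try by move=> k _; rewrite lee_fin.
Qed.

Lemma esumT_fin_num x : (forall k, 0 <= x k) -> (esumT x < +oo)%E ->
  esumT x \is a fin_num.
Proof. by move=> x0 xoo; rewrite ge0_fin_numE// esumT_ge0. Qed.

Lemma esumT0 : esumT (fun _ : T => 0%R : R) = 0%E.
Proof. by rewrite /esumT esum1. Qed.

Lemma esumTZ (c : R) x : 0 <= c -> (forall k, 0 <= x k) ->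
  esumT (fun k => c * x k)%R = (c%:E * esumT x)%E.
Proof.
rewrite le_eqVlt => /predU1P[<- _|c0 x0].
  rewrite mul0e -[RHS]esumT0; apply: eq_esumT => k; by rewrite mul0r.
have half (d : R) y : 0 < d -> (forall k, 0 <= y k) ->
    (esumT (fun k => d * y k)%R <= d%:E * esumT y)%E.
  move=> d0 y0; apply: ge_ereal_sup => _ [X [finX _] <-].
  rewrite -lee_pdivrMl//; apply: esum_ge; exists X; first by split.
  rewrite (_ : (_ * _)%E = \sum_(i \in X) (y i)%:E)%E//.
  rewrite !fsbig_finite//= !sumEFin -EFinM; congr EFin.
  by rewrite -mulr_sumr mulrA mulVf ?mul1r// gt_eqF.
apply/eqP; rewrite eq_le half//=.
rewrite -lee_pdivlMl//.
apply: le_trans (half c^-1 (fun k => c * x k) _ _); last 2 first.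
- by rewrite invr_gt0.
- by move=> k; rewrite mulr_ge0// ltW.
by apply: le_esumT => k; rewrite mulrA mulVf ?mul1r// gt_eqF.
Qed.

Lemma esumT_ge x k : (forall k, 0 <= x k) -> ((x k)%:E <= esumT x)%E.
Proof.
move=> x0; rewrite /esumT (esumID [set k])//; last by move=> i _; rewrite lee_fin.
rewrite setTI esum_set1 ?lee_fin// leeDl// esum_ge0// => i _.
by rewrite lee_fin.
Qed.

Lemma esumT_delta i (c : R) : 0 <= c ->
  esumT (fun k : T => if k == i then c else 0)%R = c%:E.
Proof.
move=> c0; rewrite /esumT (esumID [set i])//; last first.
  by move=> k _; rewrite lee_fin; case: ifP.
rewrite setTI esum_set1 ?eqxx ?lee_fin// esum1 ?adde0// => k [_ /= /eqP].
by move=> /negbTE ->.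
Qed.

Lemma le_asummable x y : (forall k, `|x k| <= y k) -> (esumT y < +oo)%E ->
  asummable x.
Proof. by move=> xy; apply: le_lt_trans; exact: le_esumT. Qed.

(** Any splitting of the family into a difference of summable nonnegative families
    computes the sum; additivity, and the exchange with integrals, come from
    choosing the splitting. *)
Lemma rsumE a b x : (forall k, 0 <= a k) -> (forall k, 0 <= b k) ->
  (esumT a < +oo)%E -> (esumT b < +oo)%E -> (forall k, x k = a k - b k) ->
  rsum x = fine (esumT a) - fine (esumT b).
Proof.
move=> a0 b0 aoo boo xE.
pose p k := Num.max (x k) 0; pose n k := Num.max (- x k) 0.
have p0 k : 0 <= p k by rewrite /p le_max lexx orbT.
have n0 k : 0 <= n k by rewrite /n le_max lexx orbT.
have poo : (esumT p < +oo)%E.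
  apply: le_lt_trans aoo; apply: le_esumT => k.
  by rewrite /p ge_max a0 xE gerBl b0.
have noo : (esumT n < +oo)%E.
  apply: le_lt_trans boo; apply: le_esumT => k.
  by rewrite /n ge_max b0 xE opprB gerBl a0.
have : (esumT p + esumT b = esumT a + esumT n)%E.
  rewrite -!esumTD//; apply: eq_esumT => k; rewrite /p /n xE.
  by rewrite opprB; case: (leP (a k - b k)); case: (leP (b k - a k)); lra.
move/(congr1 fine); rewrite !fineD ?esumT_fin_num//.
rewrite /rsum -/p -/n => /eqP; rewrite -subr_eq => /eqP; lra.
Qed.

Lemma asummable_posneg x : asummable x ->
  (esumT (fun k => Num.max (x k) 0)%R < +oo)%E /\
  (esumT (fun k => Num.max (- x k) 0)%R < +oo)%E.
Proof.
by move=> sx; split; apply: le_lt_trans sx; apply: le_esumT => k;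
  rewrite ge_max normr_ge0 andbT ?ler_norm// -normrN ler_norm.
Qed.

Lemma asummableZ c x : asummable x -> asummable (fun k => c * x k).
Proof.
move=> sx; rewrite /asummable.
under eq_esumT do rewrite normrM.
by rewrite esumTZ// -ge0_fin_numE ?mule_ge0 ?esumT_ge0// fin_numM// esumT_fin_num.
Qed.

Lemma asummableN x : asummable x -> asummable (fun k => - x k).
Proof. by move=> sx; rewrite /asummable; under eq_esumT do rewrite normrN. Qed.

Lemma maxN0 (u : R) : u = Num.max u 0 - Num.max (- u) 0.
Proof. by case: (leP u 0); case: (leP (- u) 0); lra. Qed.

Lemma rsumD x y : asummable x -> asummable y ->
  rsum (fun k => x k + y k) = rsum x + rsum y.
Proof.
move=> /asummable_posneg[xp xn] /asummable_posneg[yp yn].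
have m0 (u : R) : 0 <= Num.max u 0 by rewrite le_max lexx orbT.
rewrite (@rsumE (fun k => Num.max (x k) 0 + Num.max (y k) 0)
  (fun k => Num.max (- x k) 0 + Num.max (- y k) 0)).
- rewrite !esumTD// !fineD ?esumT_fin_num// /rsum; lra.
- by move=> k; rewrite addr_ge0.
- by move=> k; rewrite addr_ge0.
- by rewrite esumTD// lte_add_pinfty.
- by rewrite esumTD// lte_add_pinfty.
- by move=> k; rewrite {1}(maxN0 (x k)) {1}(maxN0 (y k)); lra.
Qed.

Lemma eq_rsum x y : x =1 y -> rsum x = rsum y.
Proof. by move=> xy; congr rsum; exact/funext. Qed.

Lemma rsumN x : rsum (fun k => - x k) = - rsum x.
Proof. by rewrite /rsum opprB; congr (_ - fine _); apply: eq_esumT => k; rewrite opprK. Qed.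

Lemma rsum_ge0 x : (forall k, 0 <= x k) -> rsum x = fine (esumT x).
Proof.
move=> x0; rewrite /rsum (_ : esumT (fun k => Num.max (- x k) 0)%R = 0%E) ?subr0.
  by congr fine; apply: eq_esumT => k; apply/max_idPl.
rewrite -esumT0; apply: eq_esumT => k; apply/max_idPr.
by rewrite oppr_le0.
Qed.

Lemma rsum0 : rsum (fun _ : T => 0%R : R) = 0.
Proof. by rewrite rsum_ge0// esumT0. Qed.

(** No summability is required: for c > 0 both parts are scaled, and a part with
    infinite sum contributes 0 before and after scaling. *)
Lemma rsumZ (c : R) x : rsum (fun k => c * x k) = c * rsum x.
Proof.
have m0 (u : R) : 0 <= Num.max u 0 by rewrite le_max lexx orbT.
have fineZ (d : R) (e : \bar R) : 0 < d -> fine (d%:E * e)%E = d * fine e.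
  by move=> d0; case: e => [r| |] //=;
    rewrite ?(gt0_muley, gt0_muleNy) ?lte_fin//= mulr0.
have pos d : 0 < d -> rsum (fun k => d * x k) = d * rsum x.
  move=> d0; rewrite /rsum mulrBr -!fineZ// -!esumTZ ?(ltW d0)//.
  congr (fine _ - fine _); apply: eq_esumT => k.
    by rewrite maxr_pMr ?mulr0// ltW.
  by rewrite maxr_pMr ?mulr0 ?mulrN// ltW.
have [c0|c0|<-] := ltgtP 0 c; first exact: pos.
- rewrite -[in RHS](opprK c) mulNr -pos ?oppr_gt0// -rsumN.
  by apply: eq_rsum => k; rewrite mulNr opprK.
- by rewrite mul0r -[RHS]rsum0; apply: eq_rsum => k; rewrite mul0r.
Qed.

Lemma rsumB x y : asummable x -> asummable y ->
  rsum (fun k => x k - y k) = rsum x - rsum y.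
Proof. by move=> sx sy; rewrite rsumD ?rsumN//; exact: asummableN. Qed.

Lemma le_abs_rsum x : (`|rsum x|%:E <= esumT (fun k => `|x k|)%R)%E.
Proof.
have [sx|] := ltP (esumT (fun k => `|x k|)%R) +oo%E; last first.
  by rewrite leye_eq => /eqP ->; rewrite leey.
have [xp xn] := asummable_posneg sx.
have m0 (u : R) : 0 <= Num.max u 0 by rewrite le_max lexx orbT.
apply: (@le_trans _ _ (esumT (fun k => Num.max (x k) 0)%R +
    esumT (fun k => Num.max (- x k) 0)%R)%E).
  rewrite -[leRHS]fineK ?fin_numD ?esumT_fin_num// fineD ?esumT_fin_num//.
  rewrite lee_fin /rsum (le_trans (ler_normB _ _))//.
  by rewrite !ger0_norm// fine_ge0// esumT_ge0.
rewrite -esumTD//; apply: le_esumT => k.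
case: (leP (x k) 0) => u0; case: (leP (- x k) 0) => v0; rewrite ?(gtr0_norm u0) ?(ler0_norm u0); lra.
Qed.

Lemma abs_rsum_le x y (M : R) : (forall k, `|x k| <= y k) ->
  (esumT y <= M%:E)%E -> `|rsum x| <= M.
Proof.
move=> xy yM; rewrite -lee_fin (le_trans (le_abs_rsum x))// (le_trans _ yM)//.
exact: le_esumT.
Qed.

Lemma rsum_delta i (c : R) : rsum (fun k : T => if k == i then c else 0) = c.
Proof.
have pos (d : R) : 0 <= d -> rsum (fun k : T => if k == i then d else 0) = d.
  by move=> d0; rewrite rsum_ge0 => [|k]; [rewrite esumT_delta|case: ifP].
have [c0|c0] := leP 0 c; first exact: pos.
rewrite -[RHS]opprK -(pos (- c)) ?oppr_ge0 1?ltW// -rsumN.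
by apply: eq_rsum => k; case: ifP; rewrite ?opprK ?oppr0.
Qed.

End AbsoluteSums.

Lemma esumT_reindex {R : realType} {T T' : choiceType} (e : T -> T')
    (x : T' -> R) : bijective e -> esumT (fun k => x (e k))%R = esumT x.
Proof.
move=> be; rewrite /esumT (@reindex_esum _ _ _ setT setT e)//.
split=> //; first by move=> ? ? _ _; exact: bij_inj.
by case: be => g ge eg y _; exists (g y).
Qed.

Lemma rsum_reindex {R : realType} {T T' : choiceType} (e : T -> T')
    (x : T' -> R) : bijective e -> rsum (fun k => x (e k)) = rsum x.
Proof.
move=> be; rewrite /rsum (esumT_reindex (fun k => Num.max (x k) 0))//.
by rewrite (esumT_reindex (fun k => Num.max (- x k) 0)).
Qed.

(** * Square-summable sequences and convolution *)

Section SquareSummable.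
Context {R : realType}.
Implicit Types (x y F H h : int -> R).

Lemma esum_int (x : int -> \bar R) : (forall k, 0 <= x k)%E ->
  (\esum_(k in [set: int]) x k =
   \esum_(n in [set: nat]) x (Posz n) + \esum_(n in [set: nat]) x (Negz n))%E.
Proof.
move=> x0; rewrite (esumID (range Posz))// setTI; congr (_ + _)%E.
  by rewrite esum_image// => m n _ _ [].
rewrite (_ : setT `&` ~` _ = range Negz) ?esum_image//.
- by move=> m n _ _ [].
- apply/seteqP; split => [k [_ /=]|k [n _ <-]].
    by case: k => n; [move=> /(_ (ex_intro2 _ _ n I erefl))|exists n].
  by split=> //= -[].
Qed.

Lemma esumT_int x : (forall k, 0 <= x k) ->
  esumT x = (esumT (fun n : nat => x (Posz n)) +
             esumT (fun n : nat => x (Negz n)))%E.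
Proof. by move=> x0; apply: esum_int => k; rewrite lee_fin. Qed.

Lemma esumT_geometric (a : R) : 0 <= a -> a < 1 ->
  esumT (fun n : nat => a ^+ n) = ((1 - a)^-1)%:E.
Proof.
move=> a0 a1; rewrite /esumT -nneseries_esumT; last first.
  by move=> n; rewrite lee_fin exprn_ge0.
apply/cvg_lim => //.
rewrite (_ : (fun n => _) = EFin \o series (geometric 1 a)); last first.
  by apply/funext => n /=; rewrite /series/= -sumEFin; under [RHS]eq_bigr do rewrite mul1r.
apply: cvg_EFin; first by near=> n.
rewrite -[X in _ --> X]mul1r.
by apply: cvg_geometric_series; rewrite ger0_norm.
Unshelve. all: by end_near. Qed.

Lemma esumT_geometricZ (a : R) : 0 <= a -> a < 1 ->
  esumT (fun m : int => a ^+ `|m|%N) = ((1 + a) / (1 - a))%:E.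
Proof.
move=> a0 a1; rewrite esumT_int; last by move=> k; rewrite exprn_ge0.
rewrite /= esumT_geometric//.
rewrite (_ : esumT _ = (a / (1 - a))%:E) -?EFinD; first by congr EFin; field; lra.
rewrite -[RHS]mul1e EFinM -esumT_geometric// mul1e -esumTZ//; last first.
  by move=> k; rewrite exprn_ge0.
by apply: eq_esumT => n; rewrite -exprS.
Qed.

Lemma bij_subr (m : int) : bijective (fun k : int => m - k).
Proof. by exists (fun k => m - k) => k; ring. Qed.

Lemma bij_addr (m : int) : bijective (fun k : int => k + m).
Proof. by exists (fun k => k - m) => k; ring. Qed.

Lemma bij_oppr : bijective (fun k : int => - k).
Proof. by exists (fun k => - k) => k; rewrite opprK. Qed.
End SquareSummable.

Lemma esum_exchange {R : realType} {T T' : choiceType} (a : T -> T' -> \bar R) :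
  (forall i j, 0 <= a i j)%E ->
  (\esum_(i in [set: T]) \esum_(j in [set: T']) a i j =
   \esum_(j in [set: T']) \esum_(i in [set: T]) a i j)%E.
Proof.
move=> a0; rewrite !esum_esum//.
rewrite (@reindex_esum _ _ _ ([set: T'] `*`` fun=> [set: T]) _ (fun x => (x.2, x.1)))//.
split=> //=; first by move=> [i1 i2] [j1 j2] /= _ _ [] -> ->.
by move=> [i1 i2] _; exists (i2, i1).
Qed.

(** Weighted Cauchy-Schwarz.  Summing w x <= (l w + w x^2 / l) / 2 gives a bound
    for every l > 0, and l = y / k, with y the sum of the w x, is then chosen. *)
Lemma esumT_cauchy_schwarz {R : realType} {T : choiceType} (w x : T -> R) (k : R) :
  0 < k -> (forall i, 0 <= w i) -> (forall i, 0 <= x i) ->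
  (esumT w <= k%:E)%E -> (esumT (fun i => w i * x i ^+ 2)%R < +oo)%E ->
  (esumT (fun i => w i * x i)%R < +oo)%E /\
  fine (esumT (fun i => w i * x i)) ^+ 2 <=
  k * fine (esumT (fun i => w i * x i ^+ 2)).
Proof.
move=> k0 w0 x0 wk Zoo.
have wx2 i : 0 <= w i * x i ^+ 2 by rewrite mulr_ge0// sqr_ge0.
have wx i : 0 <= w i * x i by rewrite mulr_ge0.
have wfin : esumT w \is a fin_num.
  by apply: esumT_fin_num => //; apply: le_lt_trans wk _; rewrite ltry.
set Z := fine (esumT (fun i => w i * x i ^+ 2)).
have Z0 : 0 <= Z by rewrite fine_ge0// esumT_ge0.
have key (l : R) : 0 < l ->
    (esumT (fun i => w i * x i)%R <= ((l * k + Z / l) / 2)%:E)%E.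
  move=> l0; apply: (@le_trans _ _ (esumT (fun i => (l / 2) * w i +
      (l^-1 / 2) * (w i * x i ^+ 2))%R)).
    apply: le_esumT => i.
    rewrite -subr_ge0 (_ : _ - _ = w i / (2 * l) * (l - x i) ^+ 2); last first.
      by field; rewrite gt_eqF.
    by rewrite mulr_ge0 ?sqr_ge0// divr_ge0// mulr_ge0// ltW.
  rewrite esumTD; last 2 first.
  - by move=> i; rewrite mulr_ge0// divr_ge0// ltW.
  - by move=> i; rewrite mulr_ge0// divr_ge0// invr_ge0 ltW.
  rewrite !esumTZ//; try by rewrite divr_ge0// ?invr_ge0 ltW.
  rewrite -(@fineK _ (esumT (fun i => w i * x i ^+ 2)%R)) ?esumT_fin_num// -/Z.
  rewrite -(fineK wfin) -!EFinM -EFinD lee_fin.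
  rewrite -(fineK wfin) lee_fin in wk.
  rewrite (_ : (l * k + Z / l) / 2 = l / 2 * k + l^-1 / 2 * Z); last by lra.
  by rewrite lerD// ler_wpM2l// divr_ge0// ltW.
have yoo : (esumT (fun i => w i * x i)%R < +oo)%E.
  by apply: le_lt_trans (key 1 ltr01) _; rewrite ltry.
split=> //; set y := fine (esumT (fun i => w i * x i)).
have y0 : 0 <= y by rewrite fine_ge0// esumT_ge0.
have {}key l : 0 < l -> y <= (l * k + Z / l) / 2.
  by move=> /key; rewrite -{1}(@fineK _ (esumT _)) ?esumT_fin_num.
move: y0; rewrite le_eqVlt => /predU1P[<-|y0].
  by rewrite expr0n/= mulr_ge0// ltW.
(* this l turns the bound into y <= y / 2 + k Z / (2 y) *)
have := key (y / k) (divr_gt0 y0 k0).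
rewrite divfK ?gt_eqF// invf_div => yle.
have {}yle : y <= Z * (k / y) by lra.
by rewrite expr2 -ler_pdivlMr// (le_trans yle)// mulrA (mulrC k).
Qed.

Section Convolution.
Context {R : realType}.
Implicit Types (x y F H h : int -> R).

Definition sqsum x : \bar R := esumT (fun k => x k ^+ 2).

Lemma sqsum_ge0 x : (0 <= sqsum x)%E.
Proof. by apply: esumT_ge0 => k; rewrite sqr_ge0. Qed.

Lemma sqsum_fin_num x : (sqsum x < +oo)%E -> sqsum x \is a fin_num.
Proof. by move=> xoo; rewrite ge0_fin_numE// sqsum_ge0. Qed.

Definition convZ h F (m : int) : R := rsum (fun k => h (m - k) * F k).

(** Cauchy-Schwarz with weight |h (m - j)| in j, then an exchange of the two sums. *)
Lemma young h F (k : R) : 0 < k -> (esumT (fun j => `|h j|)%R <= k%:E)%E ->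
  (sqsum F < +oo)%E ->
  (forall m, asummable (fun j => h (m - j) * F j)) /\
  (sqsum (convZ h F) <= (k ^+ 2)%:E * sqsum F)%E.
Proof.
move=> k0 hk Foo.
pose Z m := esumT (fun j => `|h (m - j)| * `|F j| ^+ 2)%R.
have Z0 m j : 0 <= `|h (m - j)| * `|F j| ^+ 2 by rewrite mulr_ge0// sqr_ge0.
have hkm m : (esumT (fun j => `|h (m - j)|)%R <= k%:E)%E.
  by rewrite (esumT_reindex (fun j => `|h j|))//; exact: bij_subr.
have hkm' m : (esumT (fun j => `|h (j - m)|)%R <= k%:E)%E.
  by rewrite (esumT_reindex (fun j => `|h j|))//; exact: (bij_addr (- m)).
have ZF : (\esum_(m in [set: int]) Z m <= k%:E * sqsum F)%E.
  rewrite /Z /esumT esum_exchange; last by move=> i j; rewrite lee_fin.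
  rewrite /sqsum -esumTZ; [|exact: ltW|by move=> j; rewrite sqr_ge0].
  rewrite /esumT; apply: le_esum => j _.
  rewrite -/(esumT (fun i => `|h (i - j)| * `|F j| ^+ 2)).
  under eq_esumT do rewrite mulrC real_normK ?num_real//.
  rewrite esumTZ ?sqr_ge0// (mulrC k) (EFinM _ k) lee_wpmul2l// lee_fin sqr_ge0//.
have Zoo m : (Z m < +oo)%E.
  apply: le_lt_trans (_ : \esum_(m in [set: int]) Z m < +oo)%E.
    rewrite (esumID [set m])//; last by move=> ? _; exact: esumT_ge0.
    rewrite setTI esum_set1 ?esumT_ge0// leeDl// esum_ge0// => ? _.
    exact: esumT_ge0.
  by rewrite (le_lt_trans ZF)// lte_mul_pinfty// ?lee_fin// ltW.
have Zfin m : Z m \is a fin_num by apply: esumT_fin_num => //; exact: Zoo.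
have CS m := @esumT_cauchy_schwarz R _ (fun j => `|h (m - j)|) (fun j => `|F j|) k
  k0 (fun j => normr_ge0 _) (fun j => normr_ge0 _) (hkm m) (Zoo m).
have sm m : asummable (fun j => h (m - j) * F j).
  by rewrite /asummable; under eq_esumT do rewrite normrM; case: (CS m).
split=> //; apply: (@le_trans _ _ (\esum_(m in [set: int]) (k%:E * Z m))%E).
  rewrite /sqsum /esumT; apply: le_esum => m _ /=.
  rewrite -(@fineK _ (Z m))// -EFinM lee_fin.
  apply: le_trans (proj2 (CS m)); rewrite -real_normK ?num_real//.
  have y0 j : 0 <= `|h (m - j)| * `|F j| by rewrite mulr_ge0.
  rewrite ler_sqr ?nnegrE//; last by rewrite fine_ge0// esumT_ge0.
  apply: (abs_rsum_le (y := fun j => `|h (m - j)| * `|F j|)).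
    by move=> j; rewrite normrM.
  by rewrite fineK// esumT_fin_num//; case: (CS m).
have -> : (\esum_(m in [set: int]) (k%:E * Z m) =
    k%:E * \esum_(m in [set: int]) Z m)%E.
  have -> : Z = fun m => (fine (Z m))%:E.
    by apply/funext => m; rewrite fineK.
  rewrite -[in RHS]/(esumT (fun m => fine (Z m))) -esumTZ ?ltW//.
  by move=> m; rewrite fine_ge0// esumT_ge0.
by rewrite expr2 EFinM -muleA lee_wpmul2l// lee_fin ltW.
Qed.

End Convolution.

Section Dominant.
Context {R : realType}.
Implicit Types (x y F H h : int -> R).

Lemma sqsumD_le x y : (sqsum (fun m => x m + y m)%R <= 2%:E * sqsum x + 2%:E * sqsum y)%E.
Proof.
rewrite /sqsum -!esumTZ//; try by move=> k; rewrite sqr_ge0.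
rewrite -esumTD; try by move=> k; rewrite mulr_ge0 ?sqr_ge0.
by apply: le_esumT => k; have := sqr_ge0 (x k - y k); nra.
Qed.

Lemma sqsumZ (c : R) x : sqsum (fun m => c * x m)%R = ((c ^+ 2)%:E * sqsum x)%E.
Proof.
rewrite /sqsum -esumTZ ?sqr_ge0//; last by move=> k; rewrite sqr_ge0.
by apply: eq_esumT => k; rewrite exprMn.
Qed.

Lemma sqsumN x : sqsum (fun m => - x m) = sqsum x.
Proof. by apply: eq_esumT => k; rewrite sqrrN. Qed.

(** Convolution by h is h 0 times the identity plus convolution by the rest h',
    whose l^1 norm is at most 25/48: the identity part dominates, so that the
    convolution is bounded below on square-summable sequences. *)
Lemma conv_dominant h F : 23 / 24 <= h 0 ->
  (forall j, `|h j| <= 25 / 24 * 5^-1 ^+ `|j|%N) -> (sqsum F < +oo)%E ->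
  (forall m, asummable (fun j => h (m - j) * F j)) /\
  ((sqsum (convZ h F) <= 3%:E * sqsum F)%E /\
   (sqsum F <= 6%:E * sqsum (convZ h F))%E).
Proof.
move=> h0 hle Foo.
have g0 (j : int) : 0 <= 5^-1 ^+ `|j|%N :> R by rewrite exprn_ge0.
have gE : esumT (fun j : int => 5^-1 ^+ `|j|%N : R) = (3 / 2)%:E.
  by rewrite esumT_geometricZ ?invr_ge0//; [congr EFin; field|lra].
have hk : (esumT (fun j => `|h j|)%R <= (25 / 16)%:E)%E.
  apply: le_trans (le_esumT hle) _.
  by rewrite esumTZ// gE -EFinM lee_fin; lra.
pose h' j := if j == 0 then 0 else h j.
have h'k : (esumT (fun j => `|h' j|)%R <= (25 / 48)%:E)%E.
  have : (esumT (fun j => `|h' j| + (if j == 0 then 25 / 24 else 0))%R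
     <= (25 / 16)%:E)%E.
    apply: (@le_trans _ _ (esumT (fun j : int => 25 / 24 * 5^-1 ^+ `|j|%N))%R).
      apply: le_esumT => j; rewrite /h'; case: eqP => [->|_].
        by rewrite normr0 expr0; lra.
      by rewrite addr0.
    by rewrite esumTZ// gE -EFinM lee_fin; lra.
  rewrite esumTD//; last by move=> j; case: ifP => //; lra.
  rewrite esumT_delta; last by lra.
  by rewrite -leeBrDr// -EFinB => /le_trans; apply; rewrite lee_fin; lra.
have [sm le1] := young (ltac:(lra) : 0 < 25 / 16 :> R) hk Foo.
have [sm' le2] := young (ltac:(lra) : 0 < 25 / 48 :> R) h'k Foo.
have Ffin := sqsum_fin_num Foo.
have Hoo : (sqsum (convZ h F) < +oo)%E.
  by apply: le_lt_trans le1 _; rewrite -(fineK Ffin) -EFinM ltry.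
have H'oo : (sqsum (convZ h' F) < +oo)%E.
  by apply: le_lt_trans le2 _; rewrite -(fineK Ffin) -EFinM ltry.
have F0 := sqsum_ge0 F.
split=> //; split.
  apply: le_trans le1 _; apply: lee_wpmul2r => //.
  by rewrite lee_fin; lra.
have dec m : convZ h F m - convZ h' F m = h 0 * F m.
  rewrite /convZ -rsumB// -(rsum_delta m (h 0 * F m)).
  apply: eq_rsum => k; rewrite /h' subr_eq0 eq_sym.
  by case: eqP => [->|_]; rewrite ?subrr ?mul0r ?subr0.
have : (sqsum (fun m => h 0 * F m)%R <= 2%:E * sqsum (convZ h F) +
   2%:E * sqsum (convZ h' F))%E.
  apply: le_trans (le_trans (sqsumD_le (convZ h F) (fun m => - convZ h' F m)) _).
    by rewrite (_ : (fun m => _) = (fun m => h 0 * F m)) //; apply/funext => m.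
  by rewrite leeD2l// sqsumN.
rewrite sqsumZ; move: le1 le2.
rewrite -(fineK Ffin) -(fineK (sqsum_fin_num Hoo)) -(fineK (sqsum_fin_num H'oo)).
rewrite -!EFinM -EFinD !lee_fin => _.
have /fine_ge0 := F0; set f := fine _; set a := fine _; set b := fine _ => f0.
move=> ble fle.
have : (23 / 24) ^+ 2 * f <= h 0 ^+ 2 * f.
  by apply: ler_wpM2r => //; rewrite ler_sqr ?nnegrE//; lra.
rewrite !expr2 in ble fle *; nra.
Qed.
End Dominant.

(** * The first order recursion *)

Section Recursion.
Context {R : realType}.
Implicit Types (x y F H h Q : int -> R).

Definition sgnZ (m : int) : R := (-1) ^+ `|m|%N.

Lemma sgnZ_sqr m : sgnZ m ^+ 2 = 1.
Proof. by rewrite /sgnZ sqrr_sign. Qed.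

Lemma sgnZB1 m : sgnZ (m - 1) = - sgnZ m.
Proof.
rewrite /sgnZ; case: m => [[|n]|n]; first by rewrite expr1 expr0.
  by rewrite (_ : (n.+1%:Z - 1) = n%:Z) ?absz_nat ?exprS ?mulN1r ?opprK//; lia.
have -> : Negz n - 1 = Negz n.+1 by rewrite !NegzE; lia.
by rewrite /= [in LHS]exprS mulN1r.
Qed.

Lemma norm_sgnZ m : `|sgnZ m| = 1.
Proof. by rewrite /sgnZ normrX normrN1 expr1n. Qed.

Lemma sgnZN m : sgnZ (- m) = sgnZ m.
Proof. by rewrite /sgnZ abszN. Qed.

Definition powpos (r : R) (m : int) : R := if 0 <= m then r ^+ `|m|%N else 0.

Lemma powpos_rec r m : powpos r m - r * powpos r (m - 1) = if m == 0 then 1 else 0.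
Proof.
rewrite /powpos; case: m => [[|n]|n].
- by rewrite /= mulr0 subr0 expr0.
- rewrite (_ : n.+1%:Z - 1 = n%:Z); last by lia.
  by rewrite /= exprS subrr.
- rewrite (_ : (0 <= Negz n - 1) = false) ?mulr0 ?subr0//; lia.
Qed.

Lemma sqsum_powpos r : 0 <= r -> r < 1 -> sqsum (powpos r) = ((1 - r ^+ 2)^-1)%:E.
Proof.
move=> r0 r1; rewrite /sqsum esumT_int; last by move=> k; rewrite sqr_ge0.
rewrite (_ : esumT (fun n => powpos r (Negz n) ^+ 2) = 0%E) ?adde0; last first.
  by rewrite -(@esumT0 R nat); apply: eq_esumT => n; rewrite /powpos/= expr0n.
rewrite -esumT_geometric ?sqr_ge0//; last by rewrite expr_lt1.
by apply: eq_esumT => n; rewrite /powpos/= exprAC.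
Qed.

(** Inverting delta_0 + r * delta_1 on square-summable sequences, uniformly as r
    tends to 1.  With the signs (-1) ^ m the relation is h m - r * h (m - 1) = g m.
    The solution with source S at the origin is S * powpos r, of squared norm
    S^2 / (1 - r^2); the remaining source g - S * delta_0 has sum zero, hence is
    the difference sequence of a decaying sequence G.  The error
    y = h - S * powpos r - G satisfies y m = r * y (m - 1) - (1 - r) * G (m - 1),
    and convexity of the square bounds its norm by that of G whatever r is. *)
Section Energy.
Variables (r M : R) (H Q : int -> R).
Hypotheses (r0 : 0 < r) (r1 : r < 1) (M0 : 0 <= M).
Hypothesis Hoo : (sqsum H < +oo)%E.
Hypothesis HQ : forall m, H m + r * H (m - 1) = Q m.
Hypothesis QM : forall m, `|Q m| <= M * 4^-1 ^+ `|m|%N.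

Let S := rsum (fun m => sgnZ m * Q m).
Let g m := sgnZ m * Q m.
Let h m := sgnZ m * H m.
Let G m := rsum (fun i => if i <= m then g i else 0) - (if 0 <= m then S else 0).

Let g_le m : `|g m| <= M * 4^-1 ^+ `|m|%N.
Proof. by rewrite normrM norm_sgnZ mul1r. Qed.

Let geo0 (m : int) : 0 <= M * 4^-1 ^+ `|m|%N.
Proof. by rewrite mulr_ge0// exprn_ge0. Qed.

Let geo_oo : (esumT (fun m : int => M * 4^-1 ^+ `|m|%N)%R < +oo)%E.
Proof.
rewrite esumTZ//.
by rewrite esumT_geometricZ; [rewrite -EFinM ltry|rewrite invr_ge0|lra].
Qed.

Let gP_summable (P : int -> bool) : asummable (fun i => if P i then g i else 0).
Proof.
apply: le_asummable geo_oo => k; case: ifP => _ //.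
by rewrite normr0.
Qed.

Let g_summable : asummable g.
Proof. by apply: le_asummable geo_oo => k. Qed.

Let G_rec m : G m - G (m - 1) = g m - (if m == 0 then S else 0).
Proof.
have -> : G m - G (m - 1) = (rsum (fun i => if i <= m then g i else 0) -
   rsum (fun i => if i <= m - 1 then g i else 0)) -
   ((if 0 <= m then S else 0) - (if 0 <= m - 1 then S else 0)) by rewrite /G; ring.
rewrite -rsumB//; congr (_ - _).
  rewrite -(rsum_delta m (g m)); apply: eq_rsum => i.
  have [->|im] := eqVneq i m; first by rewrite lexx (_ : (m <= m - 1) = false) ?subr0//; lia.
  by rewrite (_ : (i <= m - 1) = (i <= m)) ?subrr//; lia.
have [->|im] := eqVneq m 0; first by rewrite subr0.
by rewrite (_ : (0 <= m - 1) = (0 <= m)) ?subrr//; lia.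
Qed.

Let tail_le (m : int) (P : int -> bool) :
  (forall i, P i -> (`|m| <= `|i|)%N) ->
  `|rsum (fun i => if P i then g i else 0)| <= 3 * M * 2^-1 ^+ `|m|%N.
Proof.
move=> Pm.
apply: (abs_rsum_le (y := fun i : int => (M * 2^-1 ^+ `|m|%N) * 2^-1 ^+ `|i|%N)).
  move=> i; case: ifP => [Pi|_]; last first.
    by rewrite normr0 !mulr_ge0// exprn_ge0.
  apply: le_trans (g_le i) _; rewrite -mulrA ler_wpM2l//.
  (* 4 ^ - |i| splits into 2 ^ - |i|, at most 2 ^ - |m|, and a summable 2 ^ - |i| *)
  rewrite (_ : 4^-1 = 2^-1 * 2^-1 :> R); last by field.
  rewrite exprMn ler_wpM2r ?exprn_ge0//.
  apply: ler_wiXn2l; [by []|lra|exact: Pm].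
rewrite esumTZ ?mulr_ge0 ?exprn_ge0//.
rewrite esumT_geometricZ; [|by []|lra].
rewrite -EFinM lee_fin (_ : (1 + 2^-1) / (1 - 2^-1) = 3 :> R); last by field.
by rewrite mulrC mulrA.
Qed.

Let G_le m : `|G m| <= 3 * M * 2^-1 ^+ `|m|%N.
Proof.
rewrite /G; case: ifP => m0.
  have -> : rsum (fun i => if i <= m then g i else 0) - S =
     - rsum (fun i => if m < i then g i else 0).
    rewrite /S -/g -rsumB// -rsumN; apply: eq_rsum => i.
    by rewrite ltNge; case: ifP => _ /=; rewrite ?subrr ?oppr0 ?sub0r.
  by rewrite normrN; apply: tail_le => i; lia.
by rewrite subr0; apply: tail_le => i; lia.
Qed.

Let G_sqsum : (sqsum G <= (15 * M ^+ 2)%:E)%E.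
Proof.
apply: (@le_trans _ _ (esumT (fun m : int => (9 * M ^+ 2) * 4^-1 ^+ `|m|%N)%R)).
  apply: le_esumT => m; have := G_le m.
  rewrite -(@ler_sqr _ `|G m|) ?nnegrE ?normr_ge0//; last first.
    by rewrite !mulr_ge0// exprn_ge0.
  rewrite real_normK ?num_real// => /le_trans; apply.
  rewrite !exprMn -exprM mulnC exprM (_ : 2^-1 ^+ 2 = 4^-1 :> R); last by field.
  by rewrite (_ : 3 ^+ 2 = 9 :> R)//; ring.
rewrite esumTZ ?mulr_ge0 ?sqr_ge0//.
rewrite esumT_geometricZ; [|by []|lra].
by rewrite -EFinM lee_fin (_ : (1 + 4^-1) / (1 - 4^-1) = 5 / 3 :> R); [lra|field].
Qed.

Let y m := h m - S * powpos r m - G m.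

Let y_rec m : y m = r * y (m - 1) - (1 - r) * G (m - 1).
Proof.
have hm : h m = r * h (m - 1) + g m.
  by rewrite /h /g -HQ sgnZB1; ring.
have pm := powpos_rec r m.
have Gm := G_rec m.
have : S * (powpos r m - r * powpos r (m - 1)) = if m == 0 then S else 0.
  by rewrite pm; case: ifP; rewrite ?mulr1 ?mulr0.
rewrite /y hm; move: Gm; case: ifP => _; lra.
Qed.

Let sqsum_h : sqsum h = sqsum H.
Proof. by apply: eq_esumT => m; rewrite /h exprMn sgnZ_sqr mul1r. Qed.

Let sqsum_sub (u v : int -> R) : (sqsum (fun m => u m - v m)%R <=
  2%:E * sqsum u + 2%:E * sqsum v)%E.
Proof.
apply: le_trans (sqsumD_le u (fun m => - v m)) _.
by rewrite leeD2l// sqsumN.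
Qed.

Let G_oo : (sqsum G < +oo)%E.
Proof. by apply: le_lt_trans G_sqsum _; rewrite ltry. Qed.

Let Sp_oo : (sqsum (fun m => S * powpos r m)%R < +oo)%E.
Proof. by rewrite sqsumZ sqsum_powpos ?ltW// -EFinM ltry. Qed.

Let y_oo : (sqsum y < +oo)%E.
Proof.
have f2 (a : \bar R) : (a < +oo)%E -> (2%:E * a < +oo)%E.
  by move=> aoo; rewrite lte_mul_pinfty// lee_fin.
apply: le_lt_trans (sqsum_sub _ _) _.
apply: lte_add_pinfty; apply: (f2 _) => //.
apply: le_lt_trans (sqsum_sub _ _) _.
by apply: lte_add_pinfty; apply: (f2 _) => //; rewrite sqsum_h.
Qed.

Let y_sqsum : (sqsum y <= (15 * M ^+ 2)%:E)%E.
Proof.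
apply: le_trans G_sqsum.
have shift (u : int -> R) : sqsum (fun m => u (m - 1)) = sqsum u.
  by rewrite /sqsum (esumT_reindex (fun m => u m ^+ 2))//; exact: (bij_addr (-1)).
have : (sqsum y <= r%:E * sqsum y + (1 - r)%:E * sqsum G)%E.
  rewrite -{2}(shift y) -(shift G) /sqsum.
  have r1' : 0 <= 1 - r by rewrite subr_ge0 ltW.
  rewrite -!esumTZ ?(ltW r0)//; try by move=> k; rewrite sqr_ge0.
  rewrite -esumTD; try by move=> k; rewrite mulr_ge0 ?sqr_ge0// ltW.
  apply: le_esumT => m; rewrite y_rec.
  set a := y _; set b := G _.
  have : 0 <= r * (1 - r) * (a + b) ^+ 2 by rewrite mulr_ge0 ?sqr_ge0// mulr_ge0 ?(ltW r0).
  rewrite !expr2; lra.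
rewrite -(fineK (sqsum_fin_num y_oo)) -(fineK (sqsum_fin_num G_oo)).
rewrite -!EFinM -EFinD !lee_fin => le1.
rewrite -(@ler_pM2l _ (1 - r)) ?subr_gt0//; lra.
Qed.

Let sqsum3 (u v w : int -> R) :
  (sqsum (fun m => u m + v m + w m)%R <=
   3%:E * sqsum u + 3%:E * sqsum v + 3%:E * sqsum w)%E.
Proof.
rewrite /sqsum -!esumTZ//; try by move=> k; rewrite sqr_ge0.
rewrite -!esumTD; try by move=> k; rewrite ?addr_ge0// mulr_ge0 ?sqr_ge0.
apply: le_esumT => k.
have := sqr_ge0 (u k - v k); have := sqr_ge0 (u k - w k); have := sqr_ge0 (v k - w k).
rewrite !expr2; lra.
Qed.

Lemma recursion_bounds :
  (sqsum H <= (3 * (S ^+ 2 / (1 - r ^+ 2)) + 90 * M ^+ 2)%:E)%E /\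
  ((S ^+ 2 / (1 - r ^+ 2) - 90 * M ^+ 2)%:E <= 3%:E * sqsum H)%E.
Proof.
have p2 := sqsumZ S (powpos r).
rewrite sqsum_powpos ?ltW// -EFinM in p2.
have le3 (u : int -> R) (a : R) : (sqsum u <= a%:E -> 3%:E * sqsum u <= (3 * a)%:E)%E.
  by move=> ua; rewrite EFinM; apply: lee_wpmul2l.
split.
  rewrite -sqsum_h (_ : h = fun m => S * powpos r m + y m + G m); last first.
    by apply/funext => m; rewrite /y; ring.
  apply: le_trans (sqsum3 _ _ _) _; rewrite p2.
  apply: le_trans (leeD (leeD (lexx _) (le3 _ _ y_sqsum)) (le3 _ _ G_sqsum)) _.
  by rewrite -!EFinM -!EFinD lee_fin; lra.
have : ((S ^+ 2 / (1 - r ^+ 2))%:E <= 3%:E * sqsum H + 3%:E * sqsum y + 3%:E * sqsum G)%E.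
  rewrite -p2 -sqsum_h (_ : (fun m => S * powpos r m) = fun m => h m + (- y m) + (- G m)); last first.
    by apply/funext => m; rewrite /y; ring.
  apply: le_trans (sqsum3 _ _ _) _.
  by rewrite (sqsumN y) (sqsumN G).
move=> /le_trans /(_ (leeD (leeD (lexx _) (le3 _ _ y_sqsum)) (le3 _ _ G_sqsum))).
rewrite -(fineK (sqsum_fin_num Hoo)) -!EFinM -!EFinD !lee_fin; lra.
Qed.
End Energy.
End Recursion.

(** * Factorization of the sampled Gaussian *)

Section Kernel.
Context {R : realType}.
Local Notation pi := (@pi R).

Definition gaussR (x : R) : R := expR (- pi * x ^+ 2).

Lemma expRN_pi_le : expR (- pi) <= 5^-1.
Proof.
have -> : 5^-1 = (1 / 5 : R) by rewrite div1r.
rewrite expRN -div1r ler_pdivrMr ?expR_gt0//.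
apply: (@le_trans _ _ (1 / 5 * (1 + 4^-1) ^+ 8)); first by lra.
rewrite ler_wpM2l//.
apply: (@le_trans _ _ (expR 4^-1 ^+ 8)).
  by apply: lerXn2r; rewrite ?nnegrE ?expR_ge0 ?expR_ge1Dx.
rewrite -expRM_natl ler_expR; have := @pi_ge2 R; lra.
Qed.

Lemma esumT_shift (n : nat) (x : nat -> R) : (forall i, 0 <= x i) ->
  esumT (fun i : nat => if (n <= i)%N then x (i - n)%N else 0) = esumT x.
Proof.
move=> x0; rewrite /esumT (esumID (range (addn n)))//; last first.
  by move=> i _; rewrite lee_fin; case: ifP.
rewrite setTI esum_image => [|i j _ _ /addnI//].
rewrite [X in (_ + X)%E]esum1 => [|i [_ /= ni]].
  by rewrite adde0; apply: eq_esum => i _; rewrite leq_addr addKn.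
case: ifP => // {}ni'; exfalso; apply: ni.
by exists (i - n)%N => //; rewrite subnKC.
Qed.

Let q := expR (- pi).
Let q0 : 0 <= q. Proof. exact: expR_ge0. Qed.
Let q5 : q <= 5^-1. Proof. exact: expRN_pi_le. Qed.
Let q1 : q <= 1. Proof. by apply: le_trans q5 _; lra. Qed.
Let p := q ^+ 2.
Let p0 : 0 <= p. Proof. exact: sqr_ge0. Qed.
Let p25 : p <= 25^-1.
Proof.
rewrite (_ : 25^-1 = 5^-1 ^+ 2); last by field.
by rewrite lerXn2r ?nnegrE.
Qed.

(** With q = exp (- pi), these are the coefficients of the quotient of the theta
    series sum_j q ^ (j (j - 1)) z ^ j by 1 + z: the coefficient of z ^ j is
    theta_quot |j|.  The division is exact because the exponent is
    invariant under j |-> 1 - j, so that the series vanishes at z = -1. *)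
Definition theta_quot (n : nat) : R :=
  (-1) ^+ n * rsum (fun i : nat =>
    if (n <= i)%N then (-1) ^+ i * expR (- pi) ^+ (i * i.+1) else 0).

Let theta_quot_term (n i : nat) :
  `|if (n <= i)%N then (-1) ^+ i * q ^+ (i * i.+1) else 0| <=
  q ^+ (n * n.+1) * (if (n <= i)%N then p ^+ (i - n) else 0).
Proof.
case: ifP => ni; last by rewrite normr0 mulr0.
rewrite normrM normrX normrN1 expr1n mul1r ger0_norm ?exprn_ge0//.
rewrite -exprM -exprD; apply: ler_wiXn2l => //.
nia.
Qed.

Let geo_p (n : nat) :
  esumT (fun i : nat => q ^+ (n * n.+1) * (if (n <= i)%N then p ^+ (i - n) else 0))%R =
  (q ^+ (n * n.+1) / (1 - p))%:E.
Proof.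
rewrite esumTZ ?exprn_ge0//; last by move=> i; case: ifP => // _; rewrite exprn_ge0.
rewrite (esumT_shift n (x := fun i => p ^+ i)) => [|i]; last by rewrite exprn_ge0.
by rewrite esumT_geometric ?EFinM//; apply: le_lt_trans p25 _; lra.
Qed.

Let theta_quot_summable (n : nat) : asummable (fun i : nat =>
    if (n <= i)%N then (-1) ^+ i * q ^+ (i * i.+1) else 0).
Proof.
apply: (le_asummable (y := fun i : nat => q ^+ (n * n.+1) * (if (n <= i)%N then p ^+ (i - n) else 0))).
  exact: theta_quot_term.
by rewrite geo_p ltry.
Qed.

Lemma theta_quotD (n : nat) : theta_quot n + theta_quot n.+1 = expR (- pi) ^+ (n * n.+1).
Proof.
rewrite /theta_quot exprS mulN1r mulNr -mulrBr -rsumB; [|exact: theta_quot_summable..].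
rewrite (_ : rsum _ = (-1) ^+ n * q ^+ (n * n.+1)).
  by rewrite mulrA -expr2 sqrr_sign mul1r.
rewrite -(rsum_delta n (_ * _)); apply: eq_rsum => i.
have [->|ni] := eqVneq i n; first by rewrite leqnn ltnn subr0.
by rewrite [(n <= i)%N]leq_eqVlt eq_sym (negbTE ni)/= subrr.
Qed.

Lemma theta_quot_le (n : nat) : `|theta_quot n| <= 25 / 24 * expR (- pi) ^+ (n * n.+1).
Proof.
rewrite /theta_quot normrM normrX normrN1 expr1n mul1r.
apply: (abs_rsum_le (theta_quot_term n)).
rewrite geo_p lee_fin mulrC ler_wpM2r ?exprn_ge0//.
rewrite -div1r ler_pdivrMr; have := p25; lra.
Qed.

Lemma theta_quot0_ge : 23 / 24 <= theta_quot 0.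
Proof.
have := theta_quotD 0; have := theta_quot_le 1; rewrite mul0n expr0.
rewrite (_ : (1 * 2)%N = 2)// -/q -/p => /ler_normlW; have := p25; lra.
Qed.

(** The coefficients of the theta quotient at the argument r * z, where
    r = exp (- pi (1 - 2 t)): up to the factor exp (pi t^2), the sampled Gaussian
    consists of the coefficients of the theta series at r * z. *)
Definition kernelZ (t : R) (j : int) : R :=
  theta_quot `|j|%N * expR (- (pi * (1 - 2 * t)) * j%:~R).

(** The two ranges j > 0 and j <= 0 give the same relation theta_quotD, since
    j (j - 1) is symmetric about 1/2. *)
Lemma theta_quot_pair (j : int) :
  theta_quot `|j|%N + theta_quot `|j - 1|%N = expR (- pi * (j%:~R * (j%:~R - 1))).
Proof.
have e n : expR (- pi) ^+ n = expR (- pi * n%:R) by rewrite expRM_natr.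
case: (intP j) => [|n|n].
- by rewrite sub0r absz0 abszN absz1 theta_quotD mul0n expr0 mul0r mulr0 expR0.
- rewrite (_ : n.+1%:Z - 1 = n%:Z); last by lia.
  rewrite !absz_nat addrC theta_quotD e; congr (expR (_ * _)).
  by rewrite natrM -!pmulrn -natr1; ring.
- rewrite (_ : `|- n.+1%:Z|%N = n.+1); last by lia.
  rewrite (_ : `|- n.+1%:Z - 1|%N = n.+2); last by lia.
  rewrite theta_quotD e; congr (expR (_ * _)).
  by rewrite natrM mulrNz -pmulrn -!natr1; ring.
Qed.

Lemma kernelZ_rec t j : kernelZ t j + expR (- (pi * (1 - 2 * t))) * kernelZ t (j - 1)
  = expR (pi * t ^+ 2) * gaussR (t - j%:~R).
Proof.
rewrite /kernelZ mulrCA -expRD.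
rewrite (_ : - (pi * (1 - 2 * t)) + - (pi * (1 - 2 * t)) * (j - 1)%:~R =
  - (pi * (1 - 2 * t)) * j%:~R); last by rewrite intrD; ring.
rewrite -mulrDl theta_quot_pair /gaussR -!expRD; congr expR; ring.
Qed.

(** For t in [0, 1] the growth exp (pi |j|) of the powers of r is absorbed by
    q ^ (|j| (|j| + 1)), which leaves q ^ (j^2) and q <= 1/5. *)
Lemma kernelZ_le t j : 0 <= t -> t <= 1 ->
  `|kernelZ t j| <= 25 / 24 * 5^-1 ^+ `|j|%N.
Proof.
move=> t0 t1; rewrite /kernelZ normrM [X in _ * X]ger0_norm ?expR_ge0//.
set n := `|j|%N.
have r_le : expR (- (pi * (1 - 2 * t)) * j%:~R) <= expR (pi * n%:R).
  rewrite ler_expR; apply: le_trans (ler_norm _) _.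
  rewrite normrM normrN normrM ger0_norm ?pi_ge0// -mulrA ler_wpM2l ?pi_ge0//.
  rewrite -intr_norm -abszE -pmulrn -[leRHS]mul1r ler_wpM2r ?ler0n//.
  by rewrite ler_norml; lra.
apply: (@le_trans _ _ (25 / 24 * q ^+ (n * n.+1) * expR (pi * n%:R))).
  by apply: ler_pM => //; exact: theta_quot_le.
rewrite -mulrA ler_wpM2l//.
have -> : q ^+ (n * n.+1) * expR (pi * n%:R) = q ^+ (n * n).
  rewrite mulnS exprD mulrAC -[X in _ = X]mul1r; congr (_ * _).
  by rewrite -expRM_natr -expRD mulNr addNr expR0.
apply: (@le_trans _ _ (q ^+ n)); last by rewrite lerXn2r ?nnegrE ?invr_ge0.
by apply: ler_wiXn2l => //; case: (n) => // k; rewrite leq_pmulr.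
Qed.

(** The value only has to exceed the constants met in bounds_pos. *)
Definition sampling_const : R := 1440 * expR pi.

(** The factor 1 - r^2 of recursion_bounds is comparable to 1/2 - t. *)
Let bounds_pos (t M : R) (F P : int -> R) : 0 <= t -> t < 2^-1 -> 0 <= M ->
  (sqsum F < +oo)%E ->
  (forall m, P m = rsum (fun k : int => F k * gaussR (t + k%:~R - m%:~R))) ->
  (forall m, `|P m| <= M * 4^-1 ^+ `|m|%N) ->
  let S := rsum (fun m => sgnZ m * P m) in
  (sqsum F <= (sampling_const * (M ^+ 2 + S ^+ 2 / (2^-1 - t)))%:E)%E /\
  ((S ^+ 2 / (2^-1 - t))%:E <= (sampling_const * M ^+ 2)%:E + sampling_const%:E * sqsum F)%E.
Proof.
move=> t0 t1 M0 Foo PE PM S.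
have t1' : t <= 1 by lra.
have h0 : 23 / 24 <= kernelZ t 0.
  by rewrite /kernelZ mulr0 expR0 mulr1 theta_quot0_ge.
have [sm [le1 le2]] := conv_dominant h0 (fun j => kernelZ_le j t0 t1') Foo.
set r := expR (- (pi * (1 - 2 * t))).
set E := expR (pi * t ^+ 2).
set H := convZ (kernelZ t) F in le1 le2.
have r0 : 0 < r by exact: expR_gt0.
have r1 : r < 1.
  by rewrite expR_lt1 oppr_lt0 mulr_gt0 ?pi_gt0//; lra.
have E0 : 0 < E by exact: expR_gt0.
have Hoo : (sqsum H < +oo)%E.
  by apply: le_lt_trans le1 _; rewrite lte_mul_pinfty.
have HQ m : H m + r * H (m - 1) = E * P m.
  rewrite /H /convZ PE -!rsumZ -rsumD//; last exact: asummableZ.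
  apply: eq_rsum => k; rewrite mulrA -mulrDl addrAC kernelZ_rec -/E.
  by rewrite (_ : t + k%:~R - m%:~R = t - (m - k)%:~R); [ring|rewrite intrB; ring].
have QM m : `|E * P m| <= (E * M) * 4^-1 ^+ `|m|%N.
  by rewrite normrM gtr0_norm// -mulrA ler_wpM2l// ltW.
have EM0 : 0 <= E * M by rewrite mulr_ge0// ltW.
have [up lo] := recursion_bounds r0 r1 EM0 Hoo HQ QM.
have Psm : asummable (fun m => sgnZ m * P m).
  apply: (le_asummable (y := fun m : int => M * 4^-1 ^+ `|m|%N)).
    by move=> m; rewrite normrM norm_sgnZ mul1r.
  by rewrite esumTZ// esumT_geometricZ; [rewrite -EFinM ltry|rewrite invr_ge0|lra].
have SE : rsum (fun m => sgnZ m * (E * P m)) = E * S.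
  by rewrite -rsumZ//; apply: eq_rsum => m; rewrite mulrCA.
rewrite SE in up lo.
set d := 2^-1 - t; have d0 : 0 < d by rewrite /d; lra.
have r2 : r ^+ 2 = expR (- (4 * pi * d)).
  rewrite expr2 /r -expRD; congr expR; rewrite /d; lra.
have x0 : 0 <= 4 * pi * d by rewrite mulr_ge0 ?mulr_ge0 ?pi_ge0// ltW.
have pi2 := @pi_ge2 R.
have pi4 : pi < 4 by have := @pihalf_lt2 R; lra.
have rd_up : 1 - r ^+ 2 <= 16 * d.
  rewrite r2; have := expR_ge1Dx (- (4 * pi * d)).
  have : 0 <= (4 - pi) * d by rewrite mulr_ge0 ?ltW//; lra.
  lra.
have rd_lo : d / 2 <= 1 - r ^+ 2.
  have d2 : d <= 2^-1 by rewrite /d; lra.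
  have e1 := expR_ge1Dx (4 * pi * d).
  have rr : r ^+ 2 * expR (4 * pi * d) = 1 by rewrite r2 -expRD addNr expR0.
  have r21 : r ^+ 2 * (1 + 4 * pi * d) <= 1.
    by rewrite -[leRHS]rr ler_wpM2l ?sqr_ge0.
  have a : 0 <= (pi - 2) * d by rewrite mulr_ge0 ?(ltW d0)//; lra.
  have b : r ^+ 2 * (1 + 8 * d) <= 1.
    apply: le_trans r21; rewrite ler_wpM2l ?sqr_ge0//; lra.
  rewrite -subr_ge0 -(@pmulr_rge0 _ (1 + 8 * d)); last by lra.
  nra.
have rpos : 0 < 1 - r ^+ 2 by apply: lt_le_trans rd_lo; lra.
have E2 : E ^+ 2 <= expR pi.
  rewrite expr2 -expRD ler_expR.
  have : t ^+ 2 <= 4^-1 by rewrite expr2; nra.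
  move=> t2; rewrite -mulrDr -[leRHS]mulr1 ler_wpM2l ?pi_ge0//; lra.
have E1 : 1 <= E ^+ 2.
  by rewrite exprn_ege1// /E -expR0 ler_expR mulr_ge0 ?pi_ge0 ?sqr_ge0.
set V := expR pi in E2 *; have V0 : 0 <= V by exact: expR_ge0.
have S2 : 0 <= S ^+ 2 := sqr_ge0 S; have M2 : 0 <= M ^+ 2 := sqr_ge0 M.
set s := S ^+ 2 / (1 - r ^+ 2).
have s_up : s <= 2 * (S ^+ 2 / d).
  rewrite /s mulrCA ler_wpM2l// -div1r ler_pdivrMr// -ler_pdivrMl ?divr_gt0//.
  by rewrite mulr1 invf_div; move: rd_lo; lra.
have s_lo : S ^+ 2 / d <= 16 * s.
  rewrite /s mulrCA ler_wpM2l// -div1r ler_pdivrMr// mulrAC ler_pdivlMr//; lra.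
have s0 : 0 <= s by rewrite divr_ge0// ltW.
have Sd0 : 0 <= S ^+ 2 / d by rewrite divr_ge0// ltW.
rewrite !exprMn -mulrA -/s in up lo.
have EV (u : R) : 0 <= u -> E ^+ 2 * u <= V * u by move=> u0; exact: ler_wpM2r.
have EM := EV _ M2; have Es := EV _ s0.
have Es1 : s <= E ^+ 2 * s by rewrite -[leLHS]mul1r; exact: ler_wpM2r.
have Vs : V * s <= V * (2 * (S ^+ 2 / d)) by exact: ler_wpM2l.
have VM0 : 0 <= V * M ^+ 2 by exact: mulr_ge0.
have VS0 : 0 <= V * (S ^+ 2 / d) by exact: mulr_ge0.
rewrite /sampling_const -/V; split.
  apply: le_trans le2 _; apply: le_trans (lee_wpmul2l _ up) _ => //.
  rewrite -EFinM lee_fin; lra.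
have Ffin := sqsum_fin_num Foo; have Hfin := sqsum_fin_num Hoo.
have F0 : 0 <= fine (sqsum F) by rewrite fine_ge0// sqsum_ge0.
move: le1 lo; rewrite -(fineK Ffin) -(fineK Hfin) -!EFinM -EFinD !lee_fin => le1 lo.
have V1 : 1 <= V by lra.
have : fine (sqsum F) <= V * fine (sqsum F).
  by rewrite -[leLHS]mul1r; exact: ler_wpM2r.
lra.
Qed.

(** Negative t reduce to positive ones by the reflection k |-> - k, m |-> - m. *)
Lemma gauss_sampling_bounds (t M : R) (F P : int -> R) : `|t| < 2^-1 -> 0 <= M ->
  (sqsum F < +oo)%E ->
  (forall m, P m = rsum (fun k : int => F k * gaussR (t + k%:~R - m%:~R))) ->
  (forall m, `|P m| <= M * 4^-1 ^+ `|m|%N) ->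
  let S := rsum (fun m => sgnZ m * P m) in
  (sqsum F <= (sampling_const * (M ^+ 2 + S ^+ 2 / (2^-1 - `|t|)))%:E)%E /\
  ((S ^+ 2 / (2^-1 - `|t|))%:E <= (sampling_const * M ^+ 2)%:E + sampling_const%:E * sqsum F)%E.
Proof.
move=> t1 M0 Foo PE PM S.
have [t0|t0] := leP 0 t.
  by rewrite ger0_norm// in t1 *; exact: bounds_pos PE PM.
rewrite ltr0_norm// in t1 *.
have SN : S = rsum (fun m => sgnZ m * P (- m)).
  rewrite /S -(rsum_reindex (fun m => sgnZ m * P m) bij_oppr).
  by apply: eq_rsum => m; rewrite sgnZN.
have FN : sqsum F = sqsum (fun k => F (- k)).
  by rewrite /sqsum (esumT_reindex (fun k => F k ^+ 2) bij_oppr).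
rewrite SN FN; apply: bounds_pos => //.
- by rewrite oppr_ge0 ltW.
- by rewrite -FN.
- move=> m; rewrite PE -(rsum_reindex _ bij_oppr); apply: eq_rsum => k.
  rewrite /gaussR; congr (_ * expR (_ * _)); rewrite !mulrNz; ring.
- by move=> m; rewrite -(abszN m).
Qed.
End Kernel.

(** * Exchanging sums over the integers and integrals *)

Section EsumIntegral.
Context {R : realType}.

Lemma esum_int_nneseries (x : int -> \bar R) : (forall k, 0 <= x k)%E ->
  (\esum_(k in [set: int]) x k = \sum_(n <oo) x (Posz n) + \sum_(n <oo) x (Negz n))%E.
Proof. by move=> x0; rewrite esum_int// !nneseries_esumT. Qed.

Context d (T : measurableType d) (mu : {measure set T -> \bar R}).
Variables (D : set T) (mD : measurable D).

Lemma measurable_esum_int (x : int -> T -> \bar R) :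
  (forall k, measurable_fun D (x k)) -> (forall k t, D t -> 0 <= x k t)%E ->
  measurable_fun D (fun t => \esum_(k in [set: int]) x k t)%E.
Proof.
move=> mx x0.
apply: (@eq_measurable_fun _ _ _ _ _ (fun t => \sum_(n <oo) x (Posz n) t + \sum_(n <oo) x (Negz n) t)%E).
  by move=> t /set_mem Dt; rewrite esum_int_nneseries// => k; exact: x0.
by apply: emeasurable_funD; apply: ge0_emeasurable_sum => // n t Dt _; exact: x0.
Qed.

Lemma integral_esum_int (x : int -> T -> \bar R) :
  (forall k, measurable_fun D (x k)) -> (forall k t, D t -> 0 <= x k t)%E ->
  (\int[mu]_(t in D) (\esum_(k in [set: int]) x k t) =
   \esum_(k in [set: int]) \int[mu]_(t in D) x k t)%E.
Proof.
move=> mx x0.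
rewrite [RHS]esum_int_nneseries; last by move=> k; apply: integral_ge0 => t; exact: x0.
rewrite -!integral_nneseries//; try by move=> n t; exact: x0.
rewrite -ge0_integralD//.
- by apply: eq_integral => t /set_mem Dt; rewrite esum_int_nneseries// => k; exact: x0.
- by move=> t Dt; apply: nneseries_ge0 => n _ _; exact: x0.
- by apply: ge0_emeasurable_sum => // n t Dt _; exact: x0.
- by move=> t Dt; apply: nneseries_ge0 => n _ _; exact: x0.
- by apply: ge0_emeasurable_sum => // n t Dt _; exact: x0.
Qed.

Lemma integrable_fine (A : T -> \bar R) : measurable_fun D A ->
  (forall t, D t -> 0 <= A t)%E -> (\int[mu]_(t in D) A t < +oo)%E ->
  [/\ {ae mu, forall t, D t -> A t \is a fin_num},
      mu.-integrable D (EFin \o (fine \o A)) &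
      \int[mu]_(t in D) (fine (A t)) = fine (\int[mu]_(t in D) A t)%E].
Proof.
move=> mA A0 Aoo.
have iA : mu.-integrable D A.
  apply/integrableP; split=> //.
  by under eq_integral => t /set_mem Dt do rewrite gee0_abs ?A0//.
have aeA := integrable_ae mD iA.
have mfA : measurable_fun D (EFin \o (fine \o A)).
  by apply/measurable_EFinP; exact: measurableT_comp.
have ae1 : ae_eq mu D (EFin \o (fine \o A)) A.
  by apply: filterS aeA => t Afin Dt /=; rewrite fineK ?Afin.
split=> //; last by congr fine; apply: ae_eq_integral.
apply/integrableP; split=> //.
rewrite (ae_eq_integral (abse \o A))//.
- by case/integrableP: iA.
- exact: measurableT_comp.
- exact: measurableT_comp.
- exact: ae_eq_abse.
Qed.

Lemma rsum_integral (x : int -> T -> R) :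
  (forall k, measurable_fun D (x k)) ->
  (\esum_(k in [set: int]) \int[mu]_(t in D) (`|x k t|%:E) < +oo)%E ->
  [/\ {ae mu, forall t, D t -> asummable (x ^~ t)},
      mu.-integrable D (fun t => (rsum (x ^~ t))%:E) &
      \int[mu]_(t in D) (rsum (x ^~ t)) =
      rsum (fun k => \int[mu]_(t in D) x k t)].
Proof.
move=> mx xoo.
have mabs k : measurable_fun D (fun t => `|x k t|%:E).
  by apply/measurable_EFinP; exact: measurableT_comp.
have intx k : mu.-integrable D (EFin \o x k).
  apply/integrableP; split; first exact/measurable_EFinP.
  apply: le_lt_trans xoo; rewrite (esumID [set k])//; last first.
    by move=> ? _; exact: integral_ge0.
  rewrite setTI esum_set1 ?integral_ge0//= leeDl// esum_ge0// => ? _.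
  exact: integral_ge0.
pose P (s : R) k t := Num.max (s * x k t) 0.
have P0 s k t : 0 <= P s k t by rewrite le_max lexx orbT.
have mP s k : measurable_fun D (EFin \o P s k).
  apply/measurable_EFinP; apply: measurable_funrpos.
  exact: measurable_funM.
have Pabs s k t : `|s| = 1 -> P s k t <= `|x k t|.
  by move=> s1; rewrite ge_max normr_ge0 andbT (le_trans (ler_norm _))// normrM s1 mul1r.
pose A s t := esumT (fun k => P s k t).
have mA s : measurable_fun D (A s).
  refine (@measurable_esum_int (fun k t => (P s k t)%:E) (mP s) _) => k t _.
  by rewrite lee_fin.
have intA s : (\int[mu]_(t in D) A s t =
    \esum_(k in [set: int]) \int[mu]_(t in D) (P s k t)%:E)%E.
  rewrite /A /esumT integral_esum_int//; first by move=> k; exact: mP.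
  by move=> k t _; rewrite lee_fin.
have Pint s k : `|s| = 1 ->
    (\int[mu]_(t in D) (P s k t)%:E <= \int[mu]_(t in D) (`|x k t|%:E))%E.
  move=> s1; apply: ge0_le_integral => //; [|exact: mP|].
  - by move=> t _; rewrite lee_fin.
  - by move=> t _; rewrite lee_fin Pabs.
have Aoo s : `|s| = 1 -> (\int[mu]_(t in D) A s t < +oo)%E.
  move=> s1; rewrite intA; apply: le_lt_trans xoo; apply: le_esum => k _.
  exact: Pint.
have A0 s t : D t -> (0 <= A s t)%E by move=> _; exact: esumT_ge0.
have [ae1 i1 e1] := integrable_fine (mA 1) (A0 1) (Aoo 1 (normr1 R)).
have [ae2 i2 e2] := integrable_fine (mA (-1)) (A0 (-1)) (Aoo (-1) (normrN1 R)).
have rE t : rsum (x ^~ t) = fine (A 1 t) - fine (A (-1) t).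
  by rewrite /rsum /A /P; congr (fine _ - fine _); apply: eq_esumT => k;
    rewrite ?mul1r ?mulN1r.
have rEf : (fun t => (rsum (x ^~ t))%:E) =
    ((EFin \o (fine \o A 1%R)) \- (EFin \o (fine \o A (-1)%R)))%E.
  by apply/funext => t; rewrite rE EFinB.
split.
- apply: filterS2 ae1 ae2 => t f1 f2 Dt.
  rewrite /asummable (_ : (fun k => _) = fun k => P 1 k t + P (-1) k t); last first.
    apply/funext => k; rewrite /P mul1r mulN1r.
    case: (leP (x k t) 0) => u0; case: (leP (- x k t) 0) => v0;
      rewrite ?(gtr0_norm u0) ?(ler0_norm u0); lra.
  by rewrite esumTD// -ge0_fin_numE ?adde_ge0 ?esumT_ge0// fin_numD f1// f2.
- by rewrite rEf; exact: integrableB.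
- rewrite (@eq_Rintegral _ _ _ mu D (fun t => fine (A 1 t) - fine (A (-1) t))); last by move=> t _; exact: rE.
  rewrite RintegralB// e1 e2.
  have fE s k : `|s| = 1 -> (\int[mu]_(t in D) (P s k t)%:E)%E \is a fin_num.
    move=> s1; rewrite ge0_fin_numE ?integral_ge0//; last by move=> t _; rewrite lee_fin.
    apply: le_lt_trans (proj2 (integrableP _ _ _ (intx k))).
    exact: Pint.
  have EA s : `|s| = 1 -> esumT (fun k => \int[mu]_(t in D) P s k t) =
      (\int[mu]_(t in D) A s t)%E.
    by move=> s1; rewrite intA; apply: eq_esum => k _; rewrite fineK// fE.
  rewrite -!EA ?normr1 ?normrN1//; apply/esym/rsumE.
  + by move=> k; exact: Rintegral_ge0.
  + by move=> k; exact: Rintegral_ge0.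
  + by rewrite EA ?normr1// Aoo ?normr1.
  + by rewrite EA ?normrN1// Aoo ?normrN1.
  + have iP s k : `|s| = 1 -> mu.-integrable D (EFin \o P s k).
      move=> s1; apply/integrableP; split=> //.
      under eq_integral do rewrite /= ger0_norm//.
      by rewrite -ge0_fin_numE ?fE// integral_ge0// => t _; rewrite lee_fin.
    move=> k; rewrite -RintegralB ?iP ?normr1 ?normrN1//.
    by apply: eq_Rintegral => t _; rewrite /P mul1r mulN1r -maxN0.
Qed.
End EsumIntegral.

(** * Periodization *)

Section Periodization.
Context {R : realType}.
Local Notation mu := (@lebesgue_measure R).

(** Both measures give b - a to the half-open interval from a to b, which
    determines them. *)
Lemma lebesgue_measure_translate (a : R) (A : set R) : measurable A ->
  pushforward mu ((fun x => x + a) : measurableTypeR R -> measurableTypeR R) A = mu A.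
Proof.
pose phi := (fun x => x + a) : measurableTypeR R -> measurableTypeR R.
have mphi : measurable_fun setT phi by apply: measurable_funD.
pose mix := isMeasurableFun.Build _ _ _ _ _ mphi.
pose pk : {mfun _ >-> _} := HB.pack phi mix.
move=> mA; apply/esym/(@lebesgue_measure_unique R (pushforward mu pk)) => //= _ [[u v]] _ <-.
rewrite /pushforward /=.
rewrite (_ : _ @^-1` _ = `]u - a, v - a]%classic); last first.
  by apply/seteqP; split=> x /=; rewrite !in_itv/= ltrBlDr lerBrDr.
rewrite !lebesgue_measure_itv/= !lte_fin ltrD2r.
by case: ifP => // _; rewrite -!EFinB; congr EFin; ring.
Qed.

Lemma ge0_integral_translate (a : R) (f : R -> \bar R) :
  measurable_fun setT f -> (forall x, 0 <= f x)%E ->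
  (\int[mu]_x f (x + a)%R = \int[mu]_x f x)%E.
Proof.
move=> mf f0.
have mphi : measurable_fun setT ((fun x => x + a) : measurableTypeR R -> measurableTypeR R).
  by apply: measurable_funD.
rewrite -[LHS](@ge0_integral_pushforward _ _ _ _ R _ mphi mu setT f)//.
by apply: eq_measure_integral => //= A mA _; exact: lebesgue_measure_translate.
Qed.

Definition unit_itv : set R := `[- 2^-1, 2^-1[%classic.

Lemma unit_itv_tiling (t : R) : exists k : int,
  forall j : int, (t - j%:~R \in unit_itv) = (j == k).
Proof.
exists (Num.floor (t + 2^-1)) => j.
rewrite mem_setE in_itv/= [RHS]eq_sym.
apply/idP/eqP => [/andP[h1 h2]|<-].
  by apply: floor_def; rewrite intrD; apply/andP; split; lra.
have /andP[] := floor_itv (t + 2^-1).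
by rewrite intrD => h1 h2; apply/andP; split; lra.
Qed.

(** The integer translates of the unit interval tile the line, so h is the sum of
    its restrictions to them; each is moved back to the unit interval. *)
Lemma ge0_integral_periodize (h : R -> R) : measurable_fun setT h ->
  (forall x, 0 <= h x) ->
  (\int[mu]_x (h x)%:E =
   \int[mu]_(t in unit_itv) esumT (fun k : int => h (t + k%:~R)%R))%E.
Proof.
move=> mh h0.
have mI : measurable unit_itv by exact: measurable_itv.
pose g (k : int) (t : R) : R := if t - k%:~R \in unit_itv then h t else 0.
have g0 k t : 0 <= g k t by rewrite /g; case: ifP.
have hk k : measurable_fun setT (fun t : R => h (t + k)).
  by apply: measurableT_comp => //; exact: measurable_funD.
have gE k : (fun t => (g k (t + k%:~R))%:E) = (fun t => (h (t + k%:~R))%:E) \_ unit_itv.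
  by apply/funext => t; rewrite /g addrK patchE; case: ifP.
have mg k : measurable_fun setT (fun t => (g k t)%:E).
  rewrite (_ : (fun t => _) = ((fun t => (h (t + k%:~R))%:E) \_ unit_itv) \o (fun t => t - k%:~R)).
    apply: measurableT_comp; last exact: measurable_funB.
    by apply/(measurable_restrictT _ mI); apply/measurable_EFinP; exact: measurable_funTS.
  by apply/funext => t /=; rewrite -gE subrK.
transitivity (\int[mu]_x (\esum_(k in [set: int]) (g k x)%:E))%E.
  apply: eq_integral => t _; have [k kE] := unit_itv_tiling t.
  rewrite -[LHS](esumT_delta k)//; apply: eq_esumT => j.
  by rewrite /g kE.
rewrite integral_esum_int//; last by move=> k t _; rewrite lee_fin.
rewrite [in RHS]/esumT integral_esum_int//; last 2 first.
- by move=> k; apply/measurable_EFinP; exact: (measurable_funTS (hk k%:~R)).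
- by move=> k t _; rewrite lee_fin.
apply: eq_esum => k _.
rewrite -(ge0_integral_translate k%:~R)//; last by move=> t; rewrite lee_fin.
by rewrite gE -integral_mkcond.
Qed.

Definition periodize (h : R -> R) (t : R) : R := rsum (fun k : int => h (t + k%:~R)).

Lemma Rintegral_periodize (h : R -> R) : mu.-integrable setT (EFin \o h) ->
  [/\ {ae mu, forall t, unit_itv t -> asummable (fun k : int => h (t + k%:~R))},
      mu.-integrable unit_itv (EFin \o periodize h) &
      \int[mu]_(t in unit_itv) (periodize h t) = \int[mu]_x h x].
Proof.
move=> ih; have mI : measurable unit_itv by exact: measurable_itv.
have mh : measurable_fun setT h by apply/measurable_EFinP; case/integrableP: ih.
have hk k : measurable_fun setT (fun t : R => h (t + k)).
  by apply: measurableT_comp => //; exact: measurable_funD.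
have mk k : measurable_fun unit_itv (fun t : R => h (t + k)).
  exact: measurable_funTS.
have per (f : R -> R) : measurable_fun setT f -> (forall x, 0 <= f x) ->
    (\esum_(k in [set: int]) \int[mu]_(t in unit_itv) (f (t + k%:~R))%:E =
    \int[mu]_x (f x)%:E)%E.
  move=> mf f0; rewrite ge0_integral_periodize// /esumT integral_esum_int//.
    move=> k; apply/measurable_EFinP; apply: measurable_funTS.
    by apply: measurableT_comp => //; exact: measurable_funD.
  by move=> k t _; rewrite lee_fin.
have xoo : (\esum_(k in [set: int]) \int[mu]_(t in unit_itv) `|h (t + k%:~R)|%:E < +oo)%E.
  rewrite (per (fun x => `|h x|))//; last exact: measurableT_comp.
  by case/integrableP: ih.
have [ae1 i1 e1] := @rsum_integral R _ _ mu unit_itv mI (fun k t => h (t + k%:~R))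
  (fun k => mk k%:~R) xoo.
split=> //; rewrite e1.
pose P (s : R) x := Num.max (s * h x) 0.
have P0 s t : 0 <= P s t by rewrite le_max lexx orbT.
have mP s : measurable_fun setT (P s).
  by apply: measurable_funrpos; exact: measurable_funM.
have Pabs s t : `|s| = 1 -> P s t <= `|h t|.
  by move=> s1; rewrite ge_max normr_ge0 andbT (le_trans (ler_norm _))// normrM s1 mul1r.
have iP s : `|s| = 1 -> mu.-integrable setT (EFin \o P s).
  move=> s1; apply: (le_integrable _ _ _ ih) => //.
    by apply/measurable_EFinP; exact: mP.
  by move=> t _ /=; rewrite lee_fin ger0_norm ?Pabs.
have iPk s (k : int) : `|s| = 1 -> mu.-integrable unit_itv (fun t => (P s (t + k%:~R))%:E).
  move=> s1; apply/integrableP; split.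
    apply/measurable_EFinP; apply: measurable_funTS.
    by apply: measurableT_comp => //; exact: measurable_funD.
  apply: le_lt_trans xoo; rewrite (esumID [set k])//; last first.
    by move=> ? _; exact: integral_ge0.
  rewrite setTI esum_set1 ?integral_ge0// -[leLHS]adde0 leeD//; last first.
    by apply: esum_ge0 => ? _; exact: integral_ge0.
  apply: ge0_le_integral => //.
  - apply: measurableT_comp => //; apply/measurable_EFinP; apply: measurable_funTS.
    by apply: measurableT_comp => //; exact: measurable_funD.
  - by apply/measurable_EFinP; apply: measurableT_comp => //; exact: mk.
  - by move=> t _ /=; rewrite lee_fin ger0_norm ?Pabs.
have EP s : `|s| = 1 -> esumT (fun k : int => \int[mu]_(t in unit_itv) P s (t + k%:~R)) =
    (\int[mu]_x P s x)%:E.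
  move=> s1; rewrite /Rintegral fineK; last exact: integrable_fin_num (iP _ s1).
  rewrite -per//; apply: eq_esum => k _; rewrite fineK//.
  exact: integrable_fin_num (iPk _ _ s1).
rewrite (rsumE (a := fun k => \int[mu]_(t in unit_itv) P 1 (t + k%:~R))
  (b := fun k => \int[mu]_(t in unit_itv) P (-1) (t + k%:~R))).
- rewrite !EP ?normr1 ?normrN1//= -RintegralB ?iP ?normr1 ?normrN1//.
  by apply: eq_Rintegral => t _; rewrite /P mul1r mulN1r -maxN0.
- by move=> k; exact: Rintegral_ge0.
- by move=> k; exact: Rintegral_ge0.
- by rewrite EP ?normr1// ltry.
- by rewrite EP ?normrN1// ltry.
- move=> k; rewrite -RintegralB ?iPk ?normr1 ?normrN1//.
  by apply: eq_Rintegral => t _; rewrite /P mul1r mulN1r -maxN0.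
Qed.
End Periodization.

(** * Uniqueness of Fourier coefficients *)

Section FourierUniqueness.
Context {R : realType}.
Local Notation mu := (@lebesgue_measure R).
Local Notation pi := (@pi R).
Local Notation I := (@unit_itv R).

Definition cosZ (n : int) (t : R) : R := cos (2 * pi * n%:~R * t).
Definition sinZ (n : int) (t : R) : R := sin (2 * pi * n%:~R * t).

Lemma measurable_unit_itv : measurable (I : set (measurableTypeR R)). Proof. exact: measurable_itv. Qed.
Hint Resolve measurable_unit_itv : core.

Lemma measurable_cosZ n (D : set R) : measurable_fun D (cosZ n).
Proof.
apply: measurable_funTS; apply: (measurableT_comp (f := @cos R)).
  by apply: continuous_measurable_fun; exact: continuous_cos.
exact: measurable_funM.
Qed.

Lemma measurable_sinZ n (D : set R) : measurable_fun D (sinZ n).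
Proof.
apply: measurable_funTS; apply: (measurableT_comp (f := @sin R)).
  by apply: continuous_measurable_fun; exact: continuous_sin.
exact: measurable_funM.
Qed.

Lemma cosZ_mul_cos n (c t : R) : cosZ n t * cos (2 * pi * (t - c)) =
  2^-1 * (cos (2 * pi * c) * (cosZ (n + 1) t + cosZ (n - 1) t) +
          sin (2 * pi * c) * (sinZ (n + 1) t - sinZ (n - 1) t)).
Proof.
rewrite /cosZ /sinZ !intrD mulrNz mulr1z.
rewrite (_ : 2 * pi * (n%:~R + 1) * t = 2 * pi * n%:~R * t + 2 * pi * t); last by ring.
rewrite (_ : 2 * pi * (n%:~R + -1) * t = 2 * pi * n%:~R * t - 2 * pi * t); last by ring.
rewrite mulrBr !cosB !sinB !cosD !sinD.
lra.
Qed.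

Lemma sinZ_mul_cos n (c t : R) : sinZ n t * cos (2 * pi * (t - c)) =
  2^-1 * (cos (2 * pi * c) * (sinZ (n + 1) t + sinZ (n - 1) t) -
          sin (2 * pi * c) * (cosZ (n + 1) t - cosZ (n - 1) t)).
Proof.
rewrite /cosZ /sinZ !intrD mulrNz mulr1z.
rewrite (_ : 2 * pi * (n%:~R + 1) * t = 2 * pi * n%:~R * t + 2 * pi * t); last by ring.
rewrite (_ : 2 * pi * (n%:~R + -1) * t = 2 * pi * n%:~R * t - 2 * pi * t); last by ring.
rewrite mulrBr !cosB !sinB !cosD !sinD.
lra.
Qed.

Lemma integrable_mul_bounded (D : set R) (v u : R -> R) (B : R) : measurable D ->
  mu.-integrable D (EFin \o v) -> measurable_fun D u ->
  (forall t, D t -> `|u t| <= B) -> mu.-integrable D (EFin \o (fun t => v t * u t)).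
Proof.
move=> mD iv mu_ uB.
have mv : measurable_fun D v by apply/measurable_EFinP; case/integrableP: iv.
apply: (@le_integrable _ _ R mu D mD _ (fun t => B%:E * (EFin \o v) t)%E).
- by apply/measurable_EFinP; exact: measurable_funM.
- move=> t Dt /=; rewrite lee_fin !normrM mulrC ler_wpM2r//.
  by apply: le_trans (uB t Dt) _; exact: ler_norm.
- exact: integrableZl.
Qed.

Section Orthogonal.
Variable v : R -> R.
Hypothesis iv : mu.-integrable I (EFin \o v).

(** Stating the condition for all frequencies at once makes it stable under
    multiplication by trigonometric polynomials. *)
Definition fourier_null (u : R -> R) : Prop :=
  [/\ measurable_fun setT u, (exists B, forall t, `|u t| <= B) &
      forall n, \int[mu]_(t in I) (v t * (u t * cosZ n t)) = 0 /\
                \int[mu]_(t in I) (v t * (u t * sinZ n t)) = 0].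

Let iuc u n : fourier_null u ->
  mu.-integrable I (EFin \o (fun t => v t * (u t * cosZ n t))).
Proof.
move=> [mu_ [B uB] _]; apply: (integrable_mul_bounded (B := B)) => //.
  by apply: measurable_funM; [exact: measurable_funTS|exact: measurable_cosZ].
move=> t _; rewrite normrM -[leRHS]mulr1 ler_pM//.
exact: cos_max.
Qed.

Let ius u n : fourier_null u ->
  mu.-integrable I (EFin \o (fun t => v t * (u t * sinZ n t))).
Proof.
move=> [mu_ [B uB] _]; apply: (integrable_mul_bounded (B := B)) => //.
  by apply: measurable_funM; [exact: measurable_funTS|exact: measurable_sinZ].
move=> t _; rewrite normrM -[leRHS]mulr1 ler_pM//.
exact: sin_max.
Qed.

Lemma fourier_nullZ (a : R) u : fourier_null u -> fourier_null (fun t => a * u t).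
Proof.
move=> Wu; have [mu_ [B uB] u0] := Wu; split.
- exact: measurable_funM.
- by exists (`|a| * B) => t; rewrite normrM ler_wpM2l.
- move=> n; have [c0 s0] := u0 n; split.
    under eq_Rintegral do rewrite -mulrA mulrCA.
    by rewrite RintegralZl ?c0 ?mulr0//; exact: iuc.
  under eq_Rintegral do rewrite -mulrA mulrCA.
  by rewrite RintegralZl ?s0 ?mulr0//; exact: ius.
Qed.

Lemma fourier_nullB u w : fourier_null u -> fourier_null w ->
  fourier_null (fun t => u t - w t).
Proof.
move=> Wu Ww; have [mu_ [B uB] u0] := Wu; have [mw [B' wB] w0] := Ww; split.
- exact: measurable_funB.
- by exists (B + B') => t; rewrite (le_trans (ler_normB _ _))// lerD.
- move=> n; have [c0 s0] := u0 n; have [c1 s1] := w0 n; split.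
    under eq_Rintegral do rewrite mulrBl mulrBr.
    by rewrite RintegralB ?c0 ?c1 ?subr0//; exact: iuc.
  under eq_Rintegral do rewrite mulrBl mulrBr.
  by rewrite RintegralB ?s0 ?s1 ?subr0//; exact: ius.
Qed.

Lemma fourier_null_mul_cos (c : R) u : fourier_null u ->
  fourier_null (fun t => u t * cos (2 * pi * (t - c))).
Proof.
move=> Wu; have [mu_ [B uB] u0] := Wu; split.
- apply: measurable_funM => //; apply: (measurableT_comp (f := @cos R)).
    by apply: continuous_measurable_fun; exact: continuous_cos.
  by apply: measurable_funM => //; exact: measurable_funB.
- exists B => t; rewrite normrM -[leRHS]mulr1 ler_pM//; exact: cos_max.
- move=> n.
  have ic k (a : R) : mu.-integrable I (EFin \o (fun t => a * (v t * (u t * cosZ k t)))).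
    by have := integrableZl measurable_unit_itv a (iuc k Wu); congr (_.-integrable _ _); apply/funext.
  have is_ k (a : R) : mu.-integrable I (EFin \o (fun t => a * (v t * (u t * sinZ k t)))).
    by have := integrableZl measurable_unit_itv a (ius k Wu); congr (_.-integrable _ _); apply/funext.
  have comb (a b a' b' : R) (f : R -> R) : (forall t, f t =
      a * (v t * (u t * cosZ (n + 1) t)) + b * (v t * (u t * cosZ (n - 1) t)) +
      (a' * (v t * (u t * sinZ (n + 1) t)) + b' * (v t * (u t * sinZ (n - 1) t)))) ->
      \int[mu]_(t in I) f t = 0.
    move=> fE; under eq_Rintegral do rewrite fE.
    have iD (f1 f2 : R -> R) : mu.-integrable I (EFin \o f1) -> mu.-integrable I (EFin \o f2) ->
      mu.-integrable I (EFin \o (fun t => f1 t + f2 t)).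
      by move=> i1 i2; have := integrableD measurable_unit_itv i1 i2; congr (_.-integrable _ _); apply/funext.
    rewrite RintegralD ?iD// RintegralD// RintegralD//.
    rewrite !RintegralZl//; try exact: iuc; try exact: ius.
    have [-> ->] := u0 (n + 1); have [-> ->] := u0 (n - 1).
    by rewrite !mulr0 !addr0.
  split.
    apply: (comb (2^-1 * cos (2 * pi * c)) (2^-1 * cos (2 * pi * c))
      (2^-1 * sin (2 * pi * c)) (- (2^-1 * sin (2 * pi * c)))) => t.
    by rewrite -(mulrA (u t)) (mulrC (cos _)) cosZ_mul_cos; ring.
  apply: (comb (- (2^-1 * sin (2 * pi * c))) (2^-1 * sin (2 * pi * c))
      (2^-1 * cos (2 * pi * c)) (2^-1 * cos (2 * pi * c))) => t.
  by rewrite -(mulrA (u t)) (mulrC (cos _)) sinZ_mul_cos; ring.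
Qed.

(** An affine function of cos (2 pi (t - c)) with values in [0, 1], equal to 1/2 at
    the points at distance e from c; within a period around c it is smaller
    between them and larger beyond them. *)
Definition bump (c e t : R) : R :=
  2^-1 - 4^-1 * (cos (2 * pi * (t - c)) - cos (2 * pi * e)).

Lemma bump_01 c e t : 0 <= bump c e t <= 1.
Proof.
rewrite /bump; have := cos_le1 (2 * pi * (t - c)); have := cos_le1 (2 * pi * e).
have := cos_geN1 (2 * pi * (t - c)); have := cos_geN1 (2 * pi * e).
by move=> ? ? ? ?; apply/andP; split; lra.
Qed.

(** The powers (1 - x ^ n) ^ (2 ^ n) tend to 1 for x < 1/2 and to 0 for x > 1/2 by
    the Bernoulli inequality, so these trigonometric polynomials converge
    boundedly to the indicator of the interval of radius e around c. *)
Definition peak (c e : R) (n : nat) (t : R) : R := (1 - bump c e t ^+ n) ^+ (2 ^ n).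

Lemma fourier_null_mul_bump c e u : fourier_null u ->
  fourier_null (fun t => u t * bump c e t).
Proof.
move=> Wu; have := fourier_nullB
  (fourier_nullZ (2^-1 + 4^-1 * cos (2 * pi * e)) Wu)
  (fourier_nullZ 4^-1 (fourier_null_mul_cos c Wu)).
by congr fourier_null; apply/funext => t; rewrite /bump; ring.
Qed.

Lemma fourier_null_mul_peak c e n u : fourier_null u ->
  fourier_null (fun t => u t * peak c e n t).
Proof.
have X k w : fourier_null w -> fourier_null (fun t => w t * bump c e t ^+ k).
  move=> Ww; elim: k => [|k IH].
    by rewrite (_ : (fun t => _) = w)//; apply/funext => t; rewrite expr0 mulr1.
  have := fourier_null_mul_bump c e IH.
  by congr fourier_null; apply/funext => t; rewrite exprSr mulrA.
rewrite /peak => Wu; elim: (2 ^ n)%N => [|k IH].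
  by rewrite (_ : (fun t => _) = u)//; apply/funext => t; rewrite expr0 mulr1.
have := fourier_nullB IH (X n _ IH).
by congr fourier_null; apply/funext => t; rewrite exprSr; ring.
Qed.

End Orthogonal.

Lemma peak_01 c e n t : 0 <= peak c e n t <= 1.
Proof.
have /andP[b0 b1] := bump_01 c e t.
have /andP[x0 x1] : 0 <= bump c e t ^+ n <= 1 by rewrite exprn_ge0// exprn_ile1.
rewrite /peak exprn_ge0 ?exprn_ile1//; lra.
Qed.

Lemma cvg_pow_peak_lt (x : R) : 0 <= x -> x < 2^-1 ->
  (1 - x ^+ n) ^+ (2 ^ n) @[n --> \oo] --> (1 : R).
Proof.
move=> x0 x1.
have bern (a : R) N : 0 <= a -> a <= 1 -> 1 - a * N%:R <= (1 - a) ^+ N.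
  move=> a0 a1; elim: N => [|N IH]; first by rewrite mulr0 subr0 expr0.
  rewrite exprSr -natr1; have : 0 <= (1 - a) by lra.
  move/(ler_wpM2r) => /(_ _ _ IH); apply: le_trans.
  have : 0 <= a * a * N%:R by rewrite !mulr_ge0.
  lra.
have x2 : x ^+ n * 2 ^+ n @[n --> \oo] --> (0 : R).
  rewrite (_ : (fun n => _) = geometric 1 (x * 2)).
    by apply: cvg_geometric; rewrite ger0_norm; lra.
  by apply/funext => n; rewrite /= mul1r exprMn.
have x3 : 1 - x ^+ n * 2 ^+ n @[n --> \oo] --> (1 : R).
  by rewrite -[X in _ --> X]subr0; apply: cvgB => //; exact: cvg_cst.
apply: (squeeze_cvgr _ x3 (@cvg_cst _ (1 : R) _ \oo _)); near=> n.
have xn : 0 <= x ^+ n <= 1 by rewrite exprn_ge0// exprn_ile1//; lra.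
case/andP: xn => xn0 xn1.
rewrite -natrX bern//=.
by rewrite exprn_ile1//; lra.
Unshelve. all: by end_near. Qed.

Lemma cvg_pow_peak_gt (x : R) : 2^-1 < x -> x <= 1 ->
  (1 - x ^+ n) ^+ (2 ^ n) @[n --> \oo] --> (0 : R).
Proof.
move=> x0 x1.
have bern (a : R) N : 0 <= a -> 1 + a * N%:R <= (1 + a) ^+ N.
  move=> a0; elim: N => [|N IH]; first by rewrite mulr0 addr0 expr0.
  rewrite exprSr -natr1; have : 0 <= (1 + a) by lra.
  move/(ler_wpM2r) => /(_ _ _ IH); apply: le_trans.
  have : 0 <= a * a * N%:R by rewrite !mulr_ge0.
  lra.
have x2 : (x * 2)^-1 ^+ n @[n --> \oo] --> (0 : R).
  rewrite (_ : (fun n => _) = geometric 1 (x * 2)^-1).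
    by apply: cvg_geometric; rewrite ger0_norm ?invr_ge0 ?invf_lt1; lra.
  by apply/funext => n; rewrite /= mul1r.
apply: (squeeze_cvgr _ (@cvg_cst _ (0 : R) _ \oo _) x2); near=> n.
have xn : 0 <= x ^+ n <= 1 by rewrite exprn_ge0 ?exprn_ile1//; lra.
case/andP: xn => xn0 xn1.
apply/andP; split; first by rewrite exprn_ge0//; lra.
have x20 : 0 < (x * 2) ^+ n by rewrite exprn_gt0//; lra.
rewrite exprVn -div1r ler_pdivlMr//.
apply: (@le_trans _ _ ((1 - x ^+ n) ^+ (2 ^ n) * (1 + x ^+ n) ^+ (2 ^ n))).
  rewrite ler_wpM2l ?exprn_ge0//; first lra.
  apply: le_trans (bern _ _ xn0); rewrite natrX -exprMn; lra.
rewrite -exprMn exprn_ile1//; nra.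
Unshelve. all: by end_near. Qed.

Lemma cos2pi_lt (x y : R) : 0 <= x -> x < y -> y <= 2^-1 ->
  cos (2 * pi * y) < cos (2 * pi * x).
Proof.
move=> x0 xy y1; have p0 := @pi_gt0 R.
have xy' : 2 * pi * x < 2 * pi * y by rewrite ltr_pM2l// mulr_gt0.
have y1' : 2 * pi * y <= pi.
  by rewrite -[leRHS](_ : 2 * pi * 2^-1 = pi) ?ler_pM2l ?mulr_gt0//; field.
have x0' : 0 <= 2 * pi * x by rewrite mulr_ge0// mulr_ge0// ltW.
by rewrite ltr_cos// in_itv/=; apply/andP; split; lra.
Qed.

(** For |s| > 1/2 the cosine is that of 1 - |s|, and 1 - |s| still exceeds e. *)
Lemma cos2pi_lt_abs (s e : R) : 0 <= e -> e < `|s| -> `|s| < 1 - e ->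
  cos (2 * pi * s) < cos (2 * pi * e).
Proof.
move=> e0 es se.
have -> : cos (2 * pi * s) = cos (2 * pi * `|s|).
  by case: (leP 0 s) => s0; [rewrite ger0_norm|rewrite ltr0_norm// mulrN cosN].
have [sh|sh] := leP `|s| 2^-1; first exact: cos2pi_lt.
have -> : cos (2 * pi * `|s|) = cos (2 * pi * (1 - `|s|)).
  rewrite mulrBr mulr1 -[in RHS]cosN opprB (_ : 2 * pi = pi *+ 2); last by rewrite mulr2n; ring.
  by rewrite -(cosD2pi (_ - _)) subrK.
apply: cos2pi_lt; lra.
Qed.

Lemma cvg_peak (c e t : R) : 0 < e -> `|c| + e < 2^-1 -> I t -> `|t - c| != e ->
  peak c e n t @[n --> \oo] --> (if `|t - c| < e then 1 else 0 : R).
Proof.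
move=> e0 ce; rewrite /unit_itv /= in_itv/= => /andP[t1 t2] tne.
have /andP[b0 b1] := bump_01 c e t.
case: ifPn => [te|]; last rewrite -leNgt le_eqVlt eq_sym (negbTE tne)/= => te.
- apply: cvg_pow_peak_lt => //; rewrite /bump.
  have -> : cos (2 * pi * (t - c)) = cos (2 * pi * `|t - c|).
    by case: (leP 0 (t - c)) => s0; [rewrite ger0_norm|rewrite ltr0_norm// mulrN cosN].
  have := @cos2pi_lt `|t - c| e (normr_ge0 _) te; have := normr_ge0 c; lra.
- apply: cvg_pow_peak_gt => //; rewrite /bump.
  have := @cos2pi_lt_abs (t - c) e (ltW e0) te.
  have : `|t - c| <= 2^-1 + `|c|.
    by apply: le_trans (ler_normB _ _) _; rewrite lerD2r ler_norml; lra.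
  lra.
Qed.

(** Dominated convergence along the trigonometric polynomials peak. *)
Lemma fourier_coef_zero_ball (v : R -> R) (c e : R) :
  mu.-integrable I (EFin \o v) ->
  (forall n, \int[mu]_(t in I) (v t * cosZ n t) = 0) ->
  (forall n, \int[mu]_(t in I) (v t * sinZ n t) = 0) ->
  0 < e -> `|c| + e < 2^-1 ->
  \int[mu]_(t in I) (v t * (if `|t - c| < e then 1 else 0)) = 0.
Proof.
move=> iv vc vs e0 ce.
have W1 : fourier_null v (fun=> 1).
  split; [exact: measurable_cst|by exists 1 => t; rewrite normr1|].
  by move=> n; split; under eq_Rintegral do rewrite mul1r.
have zero n : (\int[mu]_(t in I) (v t * peak c e n t)%:E = 0)%E.
  have [mp _ /(_ 0)[+ _]] := fourier_null_mul_peak iv c e n W1.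
  have ip : mu.-integrable I (EFin \o (fun t => v t * peak c e n t)).
    apply: (integrable_mul_bounded (B := 1)) => //.
      have : measurable_fun I (fun t => 1 * peak c e n t) by exact: measurable_funTS.
      by under eq_fun do rewrite mul1r.
    by move=> t _; have /andP[p0 p1] := peak_01 c e n t; rewrite ger0_norm.
  under eq_Rintegral do rewrite /cosZ mulr0 mul0r cos0 mul1r mulr1.
  move=> z; have := integrable_fin_num measurable_unit_itv ip.
  by move/fineK => <-; rewrite /Rintegral in z; rewrite z.
have mb : measurable_fun I (fun t : R => if `|t - c| < e then 1 else 0 : R).
  have -> : (fun t : R => if `|t - c| < e then 1 else 0 : R) = \1_(ball c e).
    apply/funext => t; rewrite indicE /ball /=; case: ifPn => h.
      by rewrite mem_set//= distrC.
    by rewrite memNset//= distrC; exact/negP.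
  by apply: measurable_indic; exact: measurable_ball.
have mv : measurable_fun I v by apply/measurable_EFinP; case/integrableP: iv.
have mpeak n : measurable_fun I (peak c e n).
  have [mp _ _] := fourier_null_mul_peak iv c e n W1.
  have : measurable_fun I (fun t => 1 * peak c e n t) by exact: measurable_funTS.
  by under eq_fun do rewrite mul1r.
have := @dominated_convergence _ _ _ mu I measurable_unit_itv
  (fun n t => (v t * peak c e n t)%:E)
  (fun t => (v t * (if `|t - c| < e then 1 else 0))%:E) (abse \o (EFin \o v)).
case.
- by move=> n; apply/measurable_EFinP; exact: (measurable_funM mv (mpeak n)).
- by apply/measurable_EFinP; exact: (measurable_funM mv mb).
- have neg : mu.-negligible ([set c - e] `|` [set c + e]).
    by apply: negligibleU; apply/negligibleP => //; exact: lebesgue_measure_set1.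
  apply: negligibleS neg => t /= /not_implyP[It nt].
  apply: contrapT => ne; apply: nt.
  apply: cvg_EFin; first by near=> n.
  apply: cvgM; first exact: cvg_cst.
  apply: cvg_peak => //; apply/eqP => te; apply: ne.
  have [h|h] := leP 0 (t - c).
    by right => /=; move: te; rewrite ger0_norm//; lra.
  by left => /=; move: te; rewrite ltr0_norm//; lra.
- exact: integrable_abse.
- apply: aeW => t n _ /=; rewrite lee_fin normrM.
  have /andP[p0 p1] := peak_01 c e n t.
  by rewrite (ger0_norm p0) -[leRHS]mulr1 ler_wpM2l.
move=> _ _; rewrite [X in X @ _ --> _](_ : _ = fun=> 0%E); last first.
  by apply/funext => n /=; exact: zero.
move=> /(cvg_unique _ (@cvg_cst _ 0%E _ _ _)) => h.
by rewrite /Rintegral -h.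
Unshelve. all: by end_near. Qed.

(** All averages of v over small intervals vanish, and by Lebesgue differentiation
    they converge to v almost everywhere. *)
Lemma fourier_uniqueness (v : R -> R) :
  mu.-integrable I (EFin \o v) ->
  (forall n, \int[mu]_(t in I) (v t * cosZ n t) = 0) ->
  (forall n, \int[mu]_(t in I) (v t * sinZ n t) = 0) ->
  {ae mu, forall t, I t -> v t = 0}.
Proof.
move=> iv vc vs.
pose f := v \_ I.
have iF : mu.-integrable setT (EFin \o f).
  by have := (@integrable_mkcond _ _ R mu I (EFin \o v) measurable_unit_itv).1 iv;
    rewrite restrict_EFin.
have lf : locally_integrable setT f by apply: open_integrable_locally => //; exact: openT.
pose E (x : R) (n : nat) : set R := ball x (n.+1%:R^-1 : R).
have hE x : nicely_shrinking x (E x).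
  split; first by move=> n; exact: measurable_ball.
  have p n : 0 < n.+1%:R^-1 :> R by rewrite invr_gt0.
  exists (1, fun n => PosNum (p n)); split => //=; [exact: cvg_harmonic|by move=> n t|].
  by move=> n; rewrite mul1e.
have not_endpoint : {ae mu, forall t : R, t != - 2^-1}.
  have : mu.-negligible [set (- 2^-1 : R)].
    by apply/negligibleP => //; exact: lebesgue_measure_set1.
  by apply: negligibleS => t /= /negP; rewrite negbK => /eqP.
have := lebesgue_differentiation lf.
apply: filter_app; first exact: (ae_filter_ringOfSetsType mu).
move: not_endpoint; apply: filter_app; first exact: (ae_filter_ringOfSetsType mu).
apply: aeW => /= t tne lt It.
have := nice_lebesgue_differentiation hE lf lt.
have [d d0 td] : exists2 d, 0 < d & `|t| + d < 2^-1.
  move: It; rewrite /unit_itv /= in_itv/= => /andP[]; rewrite le_eqVlt eq_sym (negbTE tne)/= => t1 t2.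
  have : `|t| < 2^-1 by rewrite ltr_norml t1.
  by move=> ?; exists ((2^-1 - `|t|) / 2); lra.
have ftv : f t = v t by rewrite /f patchE mem_set.
rewrite ftv => cv.
have : (fun n => (mu (E t n))^-1 * \int[mu]_(y in E t n) (f y)%:E)%E @ \oo --> 0%E.
  apply: cvg_near_cst; near=> n.
  have nd : n.+1%:R^-1 < d by near: n; exact: near_infty_natSinv_lt (PosNum d0).
  have n0 : 0 < n.+1%:R^-1 :> R by rewrite invr_gt0.
  have tn : `|t| + n.+1%:R^-1 < 2^-1 by apply: lt_trans td; rewrite ltrD2l.
  have z := fourier_coef_zero_ball iv vc vs n0 tn.
  have -> : (\int[mu]_(y in E t n) (f y)%:E = 0)%E; last by rewrite mule0.
  have iball : mu.-integrable (E t n) (EFin \o f).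
    by apply: integrableS iF => //; exact: measurable_ball.
  rewrite -(fineK (integrable_fin_num _ iball)); last exact: measurable_ball.
  congr EFin; rewrite -[RHS]z /Rintegral; congr fine.
  rewrite integral_mkcond [in RHS]integral_mkcond; apply: eq_integral => y _.
  rewrite !patchE /= /f patchE.
  have -> : ((y : R) \in E t n) = (`|y - t| < n.+1%:R^-1).
    by rewrite distrC; apply/idP/idP => [/set_mem//|h]; exact: mem_set.
  by case: (y \in I); case: ifP; rewrite ?mulr1 ?mulr0.
move=> c0; have e : (v t)%:E = 0%E by exact: (cvg_unique _ cv c0).
by case: e.
Unshelve. all: by end_near. Qed.
End FourierUniqueness.

(** * Trigonometric series with rapidly decreasing coefficients *)

Section TrigonometricSeries.
Context {R : realType}.
Local Notation mu := (@lebesgue_measure R).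
Local Notation pi := (@pi R).
Local Notation I := (@unit_itv R).
Local Notation mI := (@measurable_unit_itv R).

Lemma sin_lipschitz (x y : R) : `|sin x - sin y| <= `|x - y|.
Proof.
wlog xy : x y / x <= y => [H|].
  by case: (leP x y) => h; [exact: H|rewrite distrC (distrC x) H// ltW].
have cs : {within `[x, y], continuous (@sin R)}.
  by apply: continuous_subspaceT => z; exact: continuous_sin.
have [c _ e] := MVT_segment xy (fun z _ => is_derive_sin z) cs.
by rewrite distrC e normrM (distrC x) -[leRHS]mul1r ler_wpM2r// cos_max.
Qed.

Lemma cos_lipschitz (x y : R) : `|cos x - cos y| <= `|x - y|.
Proof.
rewrite -!sinDpihalf; apply: le_trans (sin_lipschitz _ _) _.
by rewrite (_ : x + pi / 2 - (y + pi / 2) = x - y)//; ring.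
Qed.

Lemma freq_lipschitz (n : int) (t s : R) :
  `|2 * pi * n%:~R * t - 2 * pi * n%:~R * s| <= 8 * `|n|%N%:R * `|t - s|.
Proof.
rewrite -mulrBr normrM ler_wpM2r// normrM -intr_norm -abszE -pmulrn ler_wpM2r//.
rewrite ger0_norm ?mulr_ge0 ?pi_ge0//; have := @pihalf_lt2 R; lra.
Qed.

Lemma cosZ_lipschitz n (t s : R) : `|cosZ n t - cosZ n s| <= 8 * `|n|%N%:R * `|t - s|.
Proof. exact: le_trans (cos_lipschitz _ _) (freq_lipschitz _ _ _). Qed.

Lemma sinZ_lipschitz n (t s : R) : `|sinZ n t - sinZ n s| <= 8 * `|n|%N%:R * `|t - s|.
Proof. exact: le_trans (sin_lipschitz _ _) (freq_lipschitz _ _ _). Qed.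

Lemma cos_sin_2pi_int (k : int) :
  cos (2 * pi * k%:~R) = 1 /\ sin (2 * pi * k%:~R) = 0.
Proof.
have nat_ (n : nat) : cos (2 * pi * n%:R) = 1 /\ sin (2 * pi * n%:R) = 0.
  elim: n => [|n [IHc IHs]]; first by rewrite mulr0 cos0 sin0.
  rewrite -[n.+1%:R]natr1 mulrDr mulr1 {2 4}(_ : 2 * pi = pi *+ 2); last by rewrite mulr2n; ring.
  by rewrite cosD2pi sinD2pi.
case: k => n; first by rewrite -pmulrn.
have [c s] := nat_ n.+1; rewrite NegzE mulrNz mulrN cosN sinN -pmulrn c s.
by rewrite oppr0.
Qed.

Lemma cosZD (n k : int) (t : R) : cosZ n (t + k%:~R) = cosZ n t.
Proof.
rewrite /cosZ mulrDr -[2 * pi * n%:~R * k%:~R]mulrA -intrM cosD.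
by have [-> ->] := cos_sin_2pi_int (n * k); rewrite mulr1 mulr0 subr0.
Qed.

Lemma sinZD (n k : int) (t : R) : sinZ n (t + k%:~R) = sinZ n t.
Proof.
rewrite /sinZ mulrDr -[2 * pi * n%:~R * k%:~R]mulrA -intrM sinD.
by have [-> ->] := cos_sin_2pi_int (n * k); rewrite mulr1 mulr0 addr0.
Qed.

Lemma cosZ_le1 n (t : R) : `|cosZ n t| <= 1. Proof. exact: cos_max. Qed.
Lemma sinZ_le1 n (t : R) : `|sinZ n t| <= 1. Proof. exact: sin_max. Qed.

Lemma lebesgue_unit_itv :
  (mu : {measure set (measurableTypeR R) -> \bar R}) I = 1%E.
Proof.
transitivity (mu I) => //.
rewrite /unit_itv lebesgue_measure_itv/= lte_fin ifT; last by lra.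
by rewrite -EFinB; congr EFin; lra.
Qed.

Lemma integrable_bounded_unit (u : R -> R) (B : R) : measurable_fun I u ->
  (forall t, I t -> `|u t| <= B) -> mu.-integrable I (EFin \o u).
Proof.
move=> mu_ uB; apply: (@measurable_bounded_integrable _ _ R mu u I mI) => //.
- by rewrite lebesgue_unit_itv ltry.
- exists B; split; first exact: num_real.
  by move=> x Bx t It; apply: le_trans (uB t It) (ltW _).
Qed.

Let integrable_add (f g : R -> R) : mu.-integrable I (EFin \o f) ->
  mu.-integrable I (EFin \o g) -> mu.-integrable I (EFin \o (fun t => f t + g t)).
Proof.
by move=> i1 i2; have := @integrableD _ _ R mu I mI _ _ i1 i2; congr (_.-integrable _ _); apply/funext.
Qed.

Let integrable_sub (f g : R -> R) : mu.-integrable I (EFin \o f) ->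
  mu.-integrable I (EFin \o g) -> mu.-integrable I (EFin \o (fun t => f t - g t)).
Proof.
by move=> i1 i2; have := @integrableB _ _ R mu I mI _ _ i1 i2; congr (_.-integrable _ _); apply/funext.
Qed.

Lemma integrable_cosZ n : mu.-integrable I (EFin \o cosZ n).
Proof.
apply: (integrable_bounded_unit (B := 1)); first exact: measurable_cosZ.
by move=> t _; exact: cosZ_le1.
Qed.

Lemma integrable_sinZ n : mu.-integrable I (EFin \o sinZ n).
Proof.
apply: (integrable_bounded_unit (B := 1)); first exact: measurable_sinZ.
by move=> t _; exact: sinZ_le1.
Qed.

(** A function with a primitive of period 1 has mean zero. *)
Lemma Rintegral_unit_FTC (f F : R -> R) : (forall t : R, is_derive t 1 F (f t)) ->
  continuous f -> mu.-integrable I (EFin \o f) -> F (2^-1) = F (- 2^-1) ->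
  \int[mu]_(t in I) f t = 0.
Proof.
move=> dF cf iF FF; rewrite Rintegral_itv_bndo_bndc//.
have ab : (- 2^-1 < 2^-1 :> R)%R by lra.
have cF : continuous F.
  move=> t; apply/differentiable_continuous/derivable1_diffP.
  exact: ex_derive.
rewrite /Rintegral (@continuous_FTC2 _ f F)//.
- by rewrite FF -EFinB subrr.
- exact: continuous_subspaceT.
- split; first by move=> t _; exact: ex_derive.
    exact/cvg_at_right_filter/cF.
  exact/cvg_at_left_filter/cF.
- by move=> t _; rewrite derive1E; exact: derive_val.
Qed.

Lemma Rintegral_cosZ n : \int[mu]_(t in I) cosZ n t = (n == 0)%:R.
Proof.
have [->|n0] := eqVneq n 0.
  under eq_Rintegral do rewrite /cosZ mulr0 mul0r cos0.
  by rewrite (Rintegral_cst mu mI) lebesgue_unit_itv mulr1.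
set w := 2 * pi * n%:~R.
have w0 : w != 0 by rewrite !mulf_neq0 ?intr_eq0// gt_eqF// pi_gt0.
apply: (Rintegral_unit_FTC (F := fun t => w^-1 * sin (w * t))).
- move=> t; rewrite /cosZ -/w.
  have dw : is_derive t 1 (fun x => w * x) w.
    by apply: is_derive_eq; rewrite /GRing.scale/= mulr1 .
  have ds : is_derive t 1 (sin \o (fun x => w * x)) (cos (w * t) * w).
    exact: is_derive1_comp.
  have := @is_deriveZ _ _ _ _ w^-1 _ _ _ ds; congr is_derive.
  by rewrite /GRing.scale/= mulrCA mulVf// mulr1.
- move=> t; apply: (@continuous_comp _ _ _ ( *%R w) (@cos R)).
    exact: mulrl_continuous.
  exact: continuous_cos.
- exact: integrable_cosZ.
- congr (_ * _); have := sinZD n 1 (- 2^-1); rewrite /sinZ -/w => <-.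
  by congr (sin (_ * _)); rewrite mulr1z; field.
Qed.

Lemma Rintegral_sinZ n : \int[mu]_(t in I) sinZ n t = 0.
Proof.
have [->|n0] := eqVneq n 0.
  under eq_Rintegral do rewrite /sinZ mulr0 mul0r sin0.
  by rewrite (Rintegral_cst mu mI) mul0r.
set w := 2 * pi * n%:~R.
have w0 : w != 0 by rewrite !mulf_neq0 ?intr_eq0// gt_eqF// pi_gt0.
apply: (Rintegral_unit_FTC (F := fun t => - w^-1 * cos (w * t))).
- move=> t; rewrite /sinZ -/w.
  have dw : is_derive t 1 (fun x => w * x) w.
    by apply: is_derive_eq; rewrite /GRing.scale/= mulr1 .
  have ds : is_derive t 1 (cos \o (fun x => w * x)) (- sin (w * t) * w).
    exact: is_derive1_comp.
  have := @is_deriveZ _ _ _ _ (- w^-1) _ _ _ ds; congr is_derive.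
  by rewrite /GRing.scale/=; field.
- move=> t; apply: (@continuous_comp _ _ _ ( *%R w) (@sin R)).
    exact: mulrl_continuous.
  exact: continuous_sin.
- exact: integrable_sinZ.
- congr (_ * _); have := cosZD n 1 (- 2^-1); rewrite /cosZ -/w => <-.
  by congr (cos (_ * _)); rewrite mulr1z; field.
Qed.

Let freqB n k (t : R) : 2 * pi * (n - k)%:~R * t = 2 * pi * n%:~R * t - 2 * pi * k%:~R * t.
Proof. by rewrite intrB; ring. Qed.

Let freqD n k (t : R) : 2 * pi * (n + k)%:~R * t = 2 * pi * n%:~R * t + 2 * pi * k%:~R * t.
Proof. by rewrite intrD; ring. Qed.

Lemma mul_cosZ_cosZ n k (t : R) :
  cosZ n t * cosZ k t = 2^-1 * (cosZ (n - k) t + cosZ (n + k) t).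
Proof. by rewrite /cosZ freqB freqD cosB cosD; lra. Qed.

Lemma mul_sinZ_sinZ n k (t : R) :
  sinZ n t * sinZ k t = 2^-1 * (cosZ (n - k) t - cosZ (n + k) t).
Proof. by rewrite /cosZ /sinZ freqB freqD cosB cosD; lra. Qed.

Lemma mul_sinZ_cosZ n k (t : R) :
  sinZ n t * cosZ k t = 2^-1 * (sinZ (n - k) t + sinZ (n + k) t).
Proof. by rewrite /cosZ /sinZ freqB freqD sinB sinD; lra. Qed.

Lemma Rintegral_cosZ_cosZ n k : \int[mu]_(t in I) (cosZ n t * cosZ k t) =
  2^-1 * ((n == k)%:R + (n == - k)%:R).
Proof.
under eq_Rintegral do rewrite mul_cosZ_cosZ.
rewrite RintegralZl ?RintegralD ?Rintegral_cosZ ?subr_eq0 ?addr_eq0//;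
  try exact: mI; try exact: integrable_cosZ.
by apply: integrable_add; exact: integrable_cosZ.
Qed.

Lemma Rintegral_sinZ_sinZ n k : \int[mu]_(t in I) (sinZ n t * sinZ k t) =
  2^-1 * ((n == k)%:R - (n == - k)%:R).
Proof.
under eq_Rintegral do rewrite mul_sinZ_sinZ.
rewrite RintegralZl ?RintegralB ?Rintegral_cosZ ?subr_eq0 ?addr_eq0//;
  try exact: mI; try exact: integrable_cosZ.
by apply: integrable_sub; exact: integrable_cosZ.
Qed.

Lemma Rintegral_sinZ_cosZ n k : \int[mu]_(t in I) (sinZ n t * cosZ k t) = 0.
Proof.
under eq_Rintegral do rewrite mul_sinZ_cosZ.
rewrite RintegralZl ?RintegralD ?Rintegral_sinZ ?addr0 ?mulr0//;
  try exact: mI; try exact: integrable_sinZ.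
by apply: integrable_add; exact: integrable_sinZ.
Qed.

Section Series.
Variables (a b : int -> R) (D : R).
Hypotheses (D0 : 0 <= D) (aD : forall n, `|a n| <= D * 4^-1 ^+ `|n|%N)
  (bD : forall n, `|b n| <= D * 4^-1 ^+ `|n|%N)
  (aN : forall n, a (- n) = a n) (bN : forall n, b (- n) = - b n).

(** For a even and b odd this is the Fourier series with cosine coefficients a and
    sine coefficients b over all integer frequencies: the usual factor 2 comes
    from counting n and - n. *)
Definition trigser (t : R) : R := rsum (fun n => a n * cosZ n t + b n * sinZ n t).

Let term_le n t : `|a n * cosZ n t + b n * sinZ n t| <= (2 * D) * 4^-1 ^+ `|n|%N.
Proof.
apply: le_trans (ler_normD _ _) _; rewrite !normrM.
have h1 : `|a n| * `|cosZ n t| <= D * 4^-1 ^+ `|n|%N.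
  by rewrite -[leRHS]mulr1 ler_pM// cosZ_le1.
have h2 : `|b n| * `|sinZ n t| <= D * 4^-1 ^+ `|n|%N.
  by rewrite -[leRHS]mulr1 ler_pM// sinZ_le1.
lra.
Qed.

Let geo : esumT (fun n : int => (2 * D) * 4^-1 ^+ `|n|%N)%R = (10 / 3 * D)%:E.
Proof.
rewrite esumTZ ?mulr_ge0//; rewrite esumT_geometricZ; [|by []|lra].
by rewrite -EFinM; congr EFin; field.
Qed.

Let term_summable t : asummable (fun n => a n * cosZ n t + b n * sinZ n t).
Proof. by apply: (le_asummable (term_le ^~ t)); rewrite geo ltry. Qed.

Lemma trigser_le t : `|trigser t| <= 4 * D.
Proof.
apply: (abs_rsum_le (term_le ^~ t)); rewrite geo lee_fin.
by have := D0; lra.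
Qed.

Lemma trigser_lipschitz t s : `|trigser t - trigser s| <= 48 * D * `|t - s|.
Proof.
rewrite /trigser -rsumB//.
apply: (abs_rsum_le (y := fun n : int => (16 * D * `|t - s|) * 2^-1 ^+ `|n|%N)).
  move=> n; rewrite (_ : _ - _ = a n * (cosZ n t - cosZ n s) +
    b n * (sinZ n t - sinZ n s)); last by ring.
  apply: le_trans (ler_normD _ _) _; rewrite !normrM.
  have g0 : 0 <= 2^-1 ^+ `|n|%N :> R by rewrite exprn_ge0.
  have n2 : `|n|%N%:R * 4^-1 ^+ `|n|%N <= 2^-1 ^+ `|n|%N :> R.
    rewrite (_ : 4^-1 = 2^-1 * 2^-1 :> R); last by field.
    rewrite exprMn mulrA -[leRHS]mul1r ler_wpM2r// exprVn ler_pdivrMr ?exprn_gt0//.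
    by rewrite mul1r -natrX ler_nat ltnW// ltn_expl.
  have h1 : `|a n| * `|cosZ n t - cosZ n s| <=
     (D * 4^-1 ^+ `|n|%N) * (8 * `|n|%N%:R * `|t - s|).
    by rewrite ler_pM// cosZ_lipschitz.
  have h2 : `|b n| * `|sinZ n t - sinZ n s| <=
     (D * 4^-1 ^+ `|n|%N) * (8 * `|n|%N%:R * `|t - s|).
    by rewrite ler_pM// sinZ_lipschitz.
  have h3 : D * `|t - s| * (`|n|%N%:R * 4^-1 ^+ `|n|%N) <= D * `|t - s| * 2^-1 ^+ `|n|%N.
    by rewrite ler_wpM2l// mulr_ge0.
  move: h1 h2 h3; set p := 4^-1 ^+ _; set q := 2^-1 ^+ _; set N := _%:R.
  by set T := `|t - s|; lra.
rewrite esumTZ ?mulr_ge0//; rewrite esumT_geometricZ; [|by []|lra].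
by rewrite -EFinM lee_fin (_ : (1 + 2^-1) / (1 - 2^-1) = 3 :> R); [lra|field].
Qed.

Lemma trigserD (k : int) t : trigser (t + k%:~R) = trigser t.
Proof. by apply: eq_rsum => n; rewrite cosZD sinZD. Qed.

Let Rintegral_comb (n : int) (g : R -> R) : measurable_fun I g ->
  (forall t, `|g t| <= 1) ->
  \int[mu]_(t in I) ((a n * cosZ n t + b n * sinZ n t) * g t) =
  a n * (\int[mu]_(t in I) (cosZ n t * g t)) + b n * (\int[mu]_(t in I) (sinZ n t * g t)).
Proof.
move=> mg g1.
have ic : mu.-integrable I (EFin \o (fun t => cosZ n t * g t)).
  by apply: (integrable_mul_bounded (B := 1)) => //; [exact: mI|exact: integrable_cosZ].
have is_ : mu.-integrable I (EFin \o (fun t => sinZ n t * g t)).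
  by apply: (integrable_mul_bounded (B := 1)) => //; [exact: mI|exact: integrable_sinZ].
under eq_Rintegral do rewrite mulrDl -!mulrA.
have iZ (c : R) (f : R -> R) : mu.-integrable I (EFin \o f) ->
    mu.-integrable I (EFin \o (fun t => c * f t)).
  by move=> /(@integrableZl _ _ R mu I mI c); congr (_.-integrable _ _); apply/funext.
by rewrite RintegralD ?RintegralZl//; try exact: mI; exact: iZ.
Qed.

Let measurable_comb (n : int) : measurable_fun I (fun t => a n * cosZ n t + b n * sinZ n t).
Proof.
by apply: measurable_funD; apply: measurable_funM => //;
  [exact: measurable_cosZ|exact: measurable_sinZ].
Qed.

Let trigser_mul (g : R -> R) : measurable_fun I g -> (forall t, `|g t| <= 1) ->
  mu.-integrable I (fun t => (trigser t * g t)%:E) /\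
  \int[mu]_(t in I) (trigser t * g t) =
  rsum (fun n => a n * (\int[mu]_(t in I) (cosZ n t * g t)) +
                 b n * (\int[mu]_(t in I) (sinZ n t * g t))).
Proof.
move=> mg g1.
pose x n t := (a n * cosZ n t + b n * sinZ n t) * g t.
have mx n : measurable_fun I (x n) by apply: measurable_funM.
have x_le n t : `|x n t| <= (2 * D) * 4^-1 ^+ `|n|%N.
  by rewrite normrM -[leRHS]mulr1 ler_pM.
have xoo : (\esum_(n in [set: int]) \int[mu]_(t in I) (`|x n t|%:E) < +oo)%E.
  apply: (@le_lt_trans _ _ (esumT (fun n : int => (2 * D) * 4^-1 ^+ `|n|%N))%R); last first.
    by rewrite geo ltry.
  apply: le_esum => n _.
  apply: (@le_trans _ _ (\int[mu]_(t in I) (cst ((2 * D) * 4^-1 ^+ `|n|%N)%:E t))%E).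
    apply: ge0_le_integral => //.
    - exact: mI.
    - by apply/measurable_EFinP; apply: measurableT_comp => //; exact: mx.
    - by move=> t _ /=; rewrite lee_fin.
  by rewrite integral_cst ?lebesgue_unit_itv ?mule1//; exact: mI.
have [_ ix ex] := @rsum_integral R _ _ mu I mI x mx xoo.
have E t : rsum (x ^~ t) = trigser t * g t.
  by rewrite mulrC /trigser -rsumZ; apply: eq_rsum => n; rewrite /x mulrC.
split; first by under eq_fun do rewrite -E.
under eq_Rintegral do rewrite -E.
by rewrite ex; apply: eq_rsum => n; exact: Rintegral_comb.
Qed.

Lemma integrable_trigser : mu.-integrable I (EFin \o trigser).
Proof.
have [+ _] := @trigser_mul (fun=> 1) (measurable_cst _) (fun=> ltac:(by rewrite normr1)).
by congr (_.-integrable _ _); apply/funext => t /=; rewrite mulr1.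
Qed.

Let asummable_delta (k : int) (c : R) : asummable (fun n => if n == k then c else 0).
Proof.
rewrite /asummable (_ : (fun n => _) = fun n => if n == k then `|c| else 0).
  by rewrite esumT_delta ?ltry.
by apply/funext => n; case: ifP; rewrite ?normr0.
Qed.

(** The orthogonality relations pick the frequencies k and - k, half of the
    coefficient each. *)
Let rsum_pm (x : int -> R) (k : int) (s : R) : s * x (- k) = x k ->
  rsum (fun n => x n * (2^-1 * ((n == k)%:R + s * (n == - k)%:R))) = x k.
Proof.
move=> xN; transitivity (rsum (fun n => (if n == k then 2^-1 * x k else 0) +
                             (if n == - k then 2^-1 * x k else 0))).
  apply: eq_rsum => n; rewrite !mulrDr; congr (_ + _); case: eqP => [->|_] //=.
  - by rewrite mulr1 mulrC.
  - by rewrite !mulr0.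
  - by rewrite mulr1 mulrCA (mulrC _ s) xN.
  - by rewrite !mulr0.
by rewrite rsumD// !rsum_delta; lra.
Qed.

Lemma trigser_cos k : \int[mu]_(t in I) (trigser t * cosZ k t) = a k.
Proof.
have [_ ->] := trigser_mul (measurable_cosZ (D := I) k) (cosZ_le1 k).
rewrite -[RHS](@rsum_pm a k 1) ?mul1r ?aN//; apply: eq_rsum => n.
by rewrite Rintegral_cosZ_cosZ Rintegral_sinZ_cosZ mulr0 addr0 mul1r.
Qed.

Lemma trigser_sin k : \int[mu]_(t in I) (trigser t * sinZ k t) = b k.
Proof.
have [_ ->] := trigser_mul (measurable_sinZ (D := I) k) (sinZ_le1 k).
rewrite -[RHS](@rsum_pm b k (-1)) ?mulN1r ?bN ?opprK//; apply: eq_rsum => n.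
rewrite Rintegral_sinZ_sinZ mulN1r.
under eq_Rintegral do rewrite mulrC.
by rewrite Rintegral_sinZ_cosZ mulr0 add0r.
Qed.

End Series.
End TrigonometricSeries.

(** * The lower bound for real functions *)

Section RealSampling.
Context {R : realType}.
Local Notation mu := (@lebesgue_measure R).
Local Notation I := (@unit_itv R).
Local Notation mI := (@measurable_unit_itv R).

Lemma ae_lebesgue2 (P Q W : R -> Prop) : (forall t, P t -> Q t -> W t) ->
  {ae mu, forall t, P t} -> {ae mu, forall t, Q t} -> {ae mu, forall t, W t}.
Proof.
move=> PQW aP; apply: filter_app; first exact: (ae_filter_ringOfSetsType mu).
move: aP; apply: filter_app; first exact: (ae_filter_ringOfSetsType mu).
by apply: aeW => t /=; exact: PQW.
Qed.

Lemma ae_forall_int (P : int -> R -> Prop) :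
  (forall m, {ae mu, forall t, P m t}) -> {ae mu, forall t, forall m, P m t}.
Proof.
move=> aP.
have h1 : {ae mu, forall t, forall n : nat, P (Posz n) t}.
  by apply: ae_foralln => n; exact: aP.
have h2 : {ae mu, forall t, forall n : nat, P (Negz n) t}.
  by apply: ae_foralln => n; exact: aP.
by apply: (ae_lebesgue2 _ h1 h2) => t p1 p2; case.
Qed.

Lemma measurable_gaussR (a : R) (D : set R) : measurable_fun D (fun x => gaussR (x - a)).
Proof.
apply: measurable_funTS; apply: (measurableT_comp (f := @expR R)) => //.
apply: measurable_funM => //; apply: measurable_funX; exact: measurable_funB.
Qed.

Lemma integrable_gaussR_sqr (a : R) :
  mu.-integrable setT (EFin \o (fun x => gaussR (x - a) ^+ 2)).
Proof.
have mg : measurable_fun setT (fun x : R => gaussR (x - a) ^+ 2).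
  by apply: measurable_funX; exact: measurable_gaussR.
apply/integrableP; split; first exact/measurable_EFinP.
have /integrableP[mgf igf] := @integrableT_gauss R.
apply: le_lt_trans igf.
rewrite -[leRHS](@ge0_integral_translate _ (- a)) => [||x]; last 2 first.
- exact: measurableT_comp.
- exact: abse_ge0.
apply: ge0_le_integral => //.
- by apply: measurableT_comp => //; exact/measurable_EFinP.
- apply: (measurableT_comp (f := fun x => `|(EFin \o gauss_fun) x|%E)).
    exact: measurableT_comp.
  exact: measurable_funB.
- move=> x _ /=; rewrite lee_fin !ger0_norm ?gauss_fun_ge0 ?sqr_ge0//.
  rewrite /gauss_fun /gaussR -expRM_natl ler_expR.
  by have := @pi_ge2 R; have := sqr_ge0 (x - a); nra.
Qed.

(** On the interval of length s next to the endpoint, c / (1/2 - t) is at least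
    c / s, so that the integral of G over it is at least c; but these integrals
    tend to 0 with s by dominated convergence. *)
Lemma inverse_distance_not_integrable (c : R) (G : R -> \bar R) :
  0 <= c -> mu.-integrable `[0, 2^-1[%classic G ->
  (forall t, 0 <= G t)%E ->
  {ae mu, forall t, `[0, 2^-1[%classic t -> ((c / (2^-1 - t))%:E <= G t)%E} ->
  c = 0.
Proof.
move=> c0 iG G0 cG.
set J := `[0, 2^-1[%classic in iG cG.
have mJ : measurable (J : set (measurableTypeR R)) by exact: measurable_itv.
pose s n : R := n.+2%:R^-1.
have s0 n : 0 < s n by rewrite invr_gt0.
pose K n : set R := `[2^-1 - s n, 2^-1[%classic.
have mK n : measurable (K n : set (measurableTypeR R)) by exact: measurable_itv.
have KJ n : K n `<=` J.
  move=> t; rewrite /K /J /= !in_itv/= => /andP[t0 ->]; rewrite andbT.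
  apply: le_trans t0; rewrite subr_ge0 lef_pV2 ?posrE//.
  by rewrite ler_nat.
have mK1 n : measurable_fun J (fun t => (\1_(K n) t)%:E : \bar R).
  by apply/measurable_EFinP; apply: measurable_indic; exact: mK.
have mG : measurable_fun J G by case/integrableP: iG.
pose f n t := (G t * (\1_(K n) t)%:E)%E.
have mf n : measurable_fun J (f n) by exact: emeasurable_funM.
have f0 n t : (0 <= f n t)%E by rewrite mule_ge0// lee_fin indicE ler0n.
have lower n : (c%:E <= \int[mu]_(t in J) f n t)%E.
  have -> : c%:E = (\int[mu]_(t in J) ((c / s n)%:E * (\1_(K n) t)%:E))%E.
    have i0 t : J t -> (0 <= (\1_(K n) t : R)%:E)%E by move=> _; rewrite lee_fin indicE ler0n.
    have cs0 : 0 <= c / s n by rewrite divr_ge0// ltW.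
    rewrite (@ge0_integralZl_EFin _ _ R mu J mJ _ i0 (mK1 n) _ cs0).
    rewrite (@integral_indic _ _ R mu J mJ)// setIidl//.
    transitivity ((c / s n)%:E * mu (K n))%E => //.
    rewrite lebesgue_measure_itv/= lte_fin ifT; last by rewrite gtrBl.
    by rewrite -EFinB -EFinM opprB addrCA subrr addr0 divfK// gt_eqF.
  apply: (@ae_ge0_le_integral _ _ R mu J mJ) => //.
  - by move=> t _; rewrite mule_ge0// lee_fin ?indicE ?ler0n// divr_ge0// ltW.
  - apply: measurable_funeM; exact: mK1.
  - exact: mf.
  - apply: (ae_lebesgue2 (P := fun=> True) _ _ cG); last exact: aeW.
    move=> t _ tG Jt; rewrite /f indicE; case: (boolP (t \in K n)) => [tK|_]; last by rewrite !mule0.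
    rewrite !mule1; apply: le_trans (tG Jt); rewrite lee_fin ler_wpM2l//.
    move/set_mem: tK; rewrite /K /= in_itv/= => /andP[k1 k2].
    by rewrite lef_pV2 ?posrE ?subr_gt0//; move: k1; rewrite lerBlDr lerBlDl addrC.
have cf t : J t -> f n t @[n --> \oo] --> (0%E : \bar R).
  rewrite /J /= in_itv/= => /andP[_ t1].
  have d0 : 0 < 2^-1 - t by rewrite subr_gt0.
  apply: cvg_near_cst; near=> n.
  have nd : s n < 2^-1 - t.
    apply: (@lt_trans _ _ n.+1%:R^-1); first by rewrite /s ltf_pV2 ?posrE// ltr_nat.
    by near: n; exact: near_infty_natSinv_lt (PosNum d0).
  rewrite /f indicE memNset ?mule0// /K /= in_itv/= => /andP[k1 _].
  by move: k1; rewrite leNgt => /negP; apply; rewrite ltrBrDl -ltrBrDr.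
have f_le n t : (`|f n t| <= G t)%E.
  by rewrite gee0_abs// /f indicE; case: (t \in K n); rewrite ?mule1 ?mule0.
have [_ _ cvf] := @dominated_convergence _ _ R mu J mJ f (cst 0%E) G mf
  (measurable_cst _) (aeW mu cf) iG (aeW mu (fun t n _ => f_le n t)).
have : (c%:E <= \int[mu]_(t in J) (cst 0 t))%E.
  by apply: cvge_ge cvf; near=> n; exact: lower.
rewrite integral0 lee_fin => c00; apply/eqP; rewrite eq_le c00//.
Unshelve. all: by end_near. Qed.

(** A bound at distance d from an endpoint is transferred to the endpoint itself:
    for s and s' the values of a function with Lipschitz constant 80 * E, the
    error (s - s')^2 / d stays bounded as d tends to 0. *)
Lemma endpoint_bound (s s' d K L E n : R) : 0 < d -> d <= 2^-1 ->
  `|s - s'| <= 80 * E * d -> s' ^+ 2 / d <= K + L * n ->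
  s ^+ 2 / d <= 2 * K + 6400 * E ^+ 2 + 2 * L * n.
Proof.
move=> d0 d1 L1 le1.
have L2 : (s - s') ^+ 2 <= (80 * E * d) ^+ 2.
  rewrite -real_normK ?num_real// ler_sqr ?nnegrE//.
  exact: le_trans (normr_ge0 _) L1.
have : s ^+ 2 / d <= 2 * (s' ^+ 2 / d) + 2 * (6400 * E ^+ 2 * d).
  rewrite ler_pdivrMr// mulrDl -!mulrA mulVf ?gt_eqF// mulr1.
  rewrite (_ : (80 * E * d) ^+ 2 = 6400 * (E ^+ 2 * (d * d))) in L2; last by ring.
  have := sqr_ge0 (s - 2 * s'); move: L2; rewrite !expr2; lra.
have : E ^+ 2 * d <= E ^+ 2 * 2^-1 by rewrite ler_wpM2l ?sqr_ge0.
lra.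
Qed.

Lemma endpoint_bound_ereal (s s' d K L E : R) (n : \bar R) : 0 < d -> d <= 2^-1 ->
  n \is a fin_num ->
  `|s - s'| <= 80 * E * d -> ((s' ^+ 2 / d)%:E <= K%:E + L%:E * n)%E ->
  ((s ^+ 2 / d)%:E <= (2 * K + 6400 * E ^+ 2)%:E + (2 * L)%:E * n)%E.
Proof.
move=> d0 d1; case: n => [r| |] // _ L1.
rewrite -!EFinM -!EFinD !lee_fin; exact: endpoint_bound.
Qed.

Lemma integrable_gaussR_mul (u : R -> R) (a : R) : measurable_fun setT u ->
  (\int[mu]_x (u x ^+ 2)%:E < +oo)%E ->
  mu.-integrable setT (EFin \o (fun x => u x * gaussR (x - a))).
Proof.
move=> mu_ u2.
have iu2 : mu.-integrable setT (EFin \o (fun x => u x ^+ 2)).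
  apply/integrableP; split; first by apply/measurable_EFinP; exact: measurable_funX.
  by under eq_integral do rewrite /= ger0_norm ?sqr_ge0//.
have := @integrableD _ _ R mu setT measurableT _ _ iu2 (integrable_gaussR_sqr a).
apply: le_integrable => //.
  apply/measurable_EFinP; apply: measurable_funM => //; exact: measurable_gaussR.
move=> x _ /=; rewrite lee_fin normrM (@ger0_norm _ (gaussR _)) ?expR_ge0//.
rewrite [leRHS]ger0_norm ?addr_ge0 ?sqr_ge0//.
rewrite -(real_normK (num_real (u x))).
set w := `|u x|; set g := gaussR _.
have := sqr_ge0 (w - g); have := sqr_ge0 w; have := sqr_ge0 g.
rewrite !expr2; lra.
Qed.

Section Function.
Variables (u : R -> R) (D : R).
Hypotheses (mu_ : measurable_fun setT u) (u2 : (\int[mu]_x (u x ^+ 2)%:E < +oo)%E).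
Hypothesis D0 : 0 <= D.
Hypothesis hc : forall m n : int,
  `|\int[mu]_x (u x * gaussR (x - m%:~R) * cosZ n x)| <= D * 4^-1 ^+ (`|m|%N + `|n|%N).
Hypothesis hs : forall m n : int,
  `|\int[mu]_x (u x * gaussR (x - m%:~R) * sinZ n x)| <= D * 4^-1 ^+ (`|m|%N + `|n|%N).

Let h (m : int) (x : R) : R := u x * gaussR (x - m%:~R).
Let a (m n : int) : R := \int[mu]_x (h m x * cosZ n x).
Let b (m n : int) : R := \int[mu]_x (h m x * sinZ n x).
Let Dm (m : int) : R := D * 4^-1 ^+ `|m|%N.
Let p (m : int) (t : R) : R := trigser (a m) (b m) t.
Let N (t : R) : \bar R := sqsum (fun k : int => u (t + k%:~R)).
Let S (t : R) : R := rsum (fun m => sgnZ m * p m t).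

Let ih m : mu.-integrable setT (EFin \o h m).
Proof. exact: integrable_gaussR_mul. Qed.

Let Dm0 m : 0 <= Dm m. Proof. by rewrite mulr_ge0// exprn_ge0. Qed.

Let a_le m n : `|a m n| <= Dm m * 4^-1 ^+ `|n|%N.
Proof. by rewrite /Dm -mulrA -exprD; exact: hc. Qed.

Let b_le m n : `|b m n| <= Dm m * 4^-1 ^+ `|n|%N.
Proof. by rewrite /Dm -mulrA -exprD; exact: hs. Qed.

Let aN m n : a m (- n) = a m n.
Proof.
by apply: eq_Rintegral => x _; rewrite /cosZ mulrNz mulrN mulNr cosN.
Qed.

Let bN m n : b m (- n) = - b m n.
Proof.
have i : mu.-integrable setT (EFin \o (fun x => h m x * sinZ n x)).
  apply: (integrable_mul_bounded (B := 1)) => //; first exact: measurable_sinZ.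
  by move=> t _; exact: sinZ_le1.
have := @RintegralZl _ _ R mu setT (fun x => h m x * sinZ n x) (-1) measurableT i.
rewrite mulN1r => <-; apply: eq_Rintegral => x _.
by rewrite /sinZ mulrNz mulrN mulNr sinN; ring.
Qed.

Let p_ae m : {ae mu, forall t, I t -> periodize (h m) t = p m t}.
Proof.
have [_ iper _] := Rintegral_periodize (ih m).
have ip := integrable_trigser (Dm0 m) (a_le m) (b_le m).
have coef (g : R -> R) : measurable_fun setT g -> (forall t, `|g t| <= 1) ->
    (forall (k : int) t, g (t + k%:~R) = g t) ->
    \int[mu]_(t in I) (periodize (h m) t * g t) = \int[mu]_x (h m x * g x).
  move=> mg g1 gper.
  have ihg : mu.-integrable setT (EFin \o (fun x => h m x * g x)).
    exact: (integrable_mul_bounded (B := 1)).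
  have [_ _ <-] := Rintegral_periodize ihg.
  apply: eq_Rintegral => t _; rewrite /periodize mulrC -rsumZ.
  by apply: eq_rsum => k; rewrite gper mulrC.
have iB : mu.-integrable I (EFin \o (fun t => periodize (h m) t - p m t)).
  by have := @integrableB _ _ R mu I mI _ _ iper ip; congr (_.-integrable _ _); apply/funext.
have imul (f g : R -> R) : mu.-integrable I (EFin \o f) -> measurable_fun setT g ->
    (forall t, `|g t| <= 1) -> mu.-integrable I (EFin \o (fun t => f t * g t)).
  move=> i_f mg g1; apply: (integrable_mul_bounded (B := 1)) => //; first exact: mI.
  exact: measurable_funTS.
have z := fourier_uniqueness iB.
apply: (ae_lebesgue2 (P := fun=> True) (Q := fun t => I t -> periodize (h m) t - p m t = 0)).
- by move=> t _ pe It; apply/eqP; rewrite -subr_eq0; apply/eqP; exact: pe.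
- exact: aeW.
apply: z => n.
- under eq_Rintegral do rewrite mulrBl.
  have mg := @measurable_cosZ R n setT; have g1 := @cosZ_le1 R n.
  have pc : \int[mu]_(t in I) (p m t * cosZ n t) = a m n.
    exact: (trigser_cos (Dm0 m) (a_le m) (b_le m) (aN m)).
  rewrite RintegralB ?coef ?pc ?subrr//; try exact: mI; try exact: imul.
  by move=> k t; exact: cosZD.
- under eq_Rintegral do rewrite mulrBl.
  have mg := @measurable_sinZ R n setT; have g1 := @sinZ_le1 R n.
  have pc : \int[mu]_(t in I) (p m t * sinZ n t) = b m n.
    exact: (trigser_sin (Dm0 m) (a_le m) (b_le m) (bN m)).
  rewrite RintegralB ?coef ?pc ?subrr//; try exact: mI; try exact: imul.
  by move=> k t; exact: sinZD.
Qed.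

Let mN : measurable_fun I N.
Proof.
apply: (@measurable_esum_int R _ _ I (fun k t => (u (t + k%:~R) ^+ 2)%:E)).
  move=> k; apply/measurable_EFinP; apply: measurable_funTS; apply: measurable_funX.
  by apply: measurableT_comp => //; exact: measurable_funD.
by move=> k t _; rewrite lee_fin sqr_ge0.
Qed.

Let intN : (\int[mu]_(t in I) N t = \int[mu]_x (u x ^+ 2)%:E)%E.
Proof.
rewrite (@ge0_integral_periodize R (fun x => u x ^+ 2))//.
  exact: measurable_funX.
by move=> x; exact: sqr_ge0.
Qed.

Let good t := [/\ `|t| < 2^-1, (N t < +oo)%E & forall m, periodize (h m) t = p m t].

(** The left endpoint -1/2 of the period is discarded, as the comparison of
    gauss_sampling_bounds degenerates there. *)
Let good_ae : {ae mu, forall t, I t -> good t}.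
Proof.
have [aeN _ _] := @integrable_fine R _ _ mu I mI N mN (fun t _ => sqsum_ge0 _)
  (ltac:(by rewrite intN)).
have ne : {ae mu, forall t : R, t != - 2^-1}.
  have : mu.-negligible [set (- 2^-1 : R)].
    by apply/negligibleP => //; exact: lebesgue_measure_set1.
  by apply: negligibleS => t /= /negP; rewrite negbK => /eqP.
apply: (ae_lebesgue2 _ (ae_forall_int p_ae) (ae_lebesgue2 (fun t h1 h2 => conj h1 h2) aeN ne)).
move=> t pt [Nt tne] It; split.
- move: It; rewrite /unit_itv /= in_itv/= => /andP[].
  by rewrite le_eqVlt eq_sym (negbTE tne)/= => t1 t2; rewrite ltr_norml t1.
- by rewrite -ge0_fin_numE ?Nt// sqsum_ge0.
- by move=> m; exact: pt.
Qed.

Let p_le m t : `|p m t| <= 4 * D * 4^-1 ^+ `|m|%N.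
Proof. by rewrite -mulrA; exact: (trigser_le (Dm0 m) (a_le m) (b_le m)). Qed.

Let sum4 (c : R) : 0 <= c ->
  esumT (fun m : int => c * 4^-1 ^+ `|m|%N)%R = (5 / 3 * c)%:E.
Proof.
move=> c0; rewrite esumTZ//; rewrite esumT_geometricZ; [|by []|lra].
by rewrite -EFinM; congr EFin; field.
Qed.

Let Ssum t : asummable (fun m => sgnZ m * p m t).
Proof.
apply: (le_asummable (y := fun m : int => 4 * D * 4^-1 ^+ `|m|%N)).
  by move=> m; rewrite normrM norm_sgnZ mul1r.
by rewrite sum4 ?mulr_ge0// ltry.
Qed.

Let S_lipschitz t s : `|S t - S s| <= 80 * D * `|t - s|.
Proof.
rewrite /S -rsumB//.
apply: (abs_rsum_le (y := fun m : int => (48 * D * `|t - s|) * 4^-1 ^+ `|m|%N)).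
  move=> m; rewrite -mulrBr normrM norm_sgnZ mul1r.
  apply: le_trans (trigser_lipschitz (Dm0 m) (a_le m) (b_le m) _ _) _.
  by rewrite /Dm le_eqVlt; apply/orP; left; apply/eqP; ring.
by rewrite sum4 ?mulr_ge0// lee_fin; lra.
Qed.

Let S_periodic (k : int) t : S (t + k%:~R) = S t.
Proof. by apply: eq_rsum => m; rewrite /p trigserD. Qed.

Let bounds t : good t ->
  (N t <= (sampling_const * ((4 * D) ^+ 2 + S t ^+ 2 / (2^-1 - `|t|)))%:E)%E /\
  ((S t ^+ 2 / (2^-1 - `|t|))%:E <= (sampling_const * (4 * D) ^+ 2)%:E + sampling_const%:E * N t)%E.
Proof.
move=> [t1 Nt pt].
have D4 : 0 <= 4 * D by rewrite mulr_ge0.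
apply: (gauss_sampling_bounds t1 D4 Nt (P := p ^~ t)).
  by move=> m; rewrite -pt; apply: eq_rsum => k; rewrite /h addrAC.
by move=> m; exact: p_le.
Qed.

Let c1 : R := 2 * (sampling_const * (4 * D) ^+ 2) + 6400 * D ^+ 2.
Let c2 : R := 2 * sampling_const.
Let G (t : R) : \bar R := (c1%:E + c2%:E * N t)%E.
Let J : set R := `[0, 2^-1[%classic.

Let sampling_const0 : 0 <= sampling_const :> R.
Proof. by rewrite /sampling_const; apply: mulr_ge0; [exact: ler0n|exact: expR_ge0]. Qed.

Let S_half_bound t : good t -> J t -> ((S 2^-1 ^+ 2 / (2^-1 - t))%:E <= G t)%E.
Proof.
move=> gt; rewrite /J /= in_itv/= => /andP[t0 t1].
have [_ le1] := bounds gt; have [_ Nt _] := gt.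
rewrite (ger0_norm t0) in le1.
have L := S_lipschitz 2^-1 t; rewrite [X in _ <= _ * X]gtr0_norm ?subr_gt0// in L.
apply: endpoint_bound_ereal L le1.
- by rewrite subr_gt0.
- by rewrite lerBlDr lerDl.
- exact: sqsum_fin_num.
Qed.

Let JI : J `<=` I.
Proof.
move=> t; rewrite /J /unit_itv /= !in_itv/= => /andP[t0 t1]; apply/andP; split=> //; lra.
Qed.

Let mJ : measurable (J : set (measurableTypeR R)).
Proof. exact: measurable_itv. Qed.

Let c10 : 0 <= c1.
Proof.
apply: addr_ge0; last by apply: mulr_ge0; [exact: ler0n|exact: sqr_ge0].
apply: mulr_ge0; first exact: ler0n.
by apply: mulr_ge0; [exact: sampling_const0|exact: sqr_ge0].
Qed.

Let c20 : 0 <= c2.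
Proof. by apply: mulr_ge0; [exact: ler0n|exact: sampling_const0]. Qed.

Let G0 t : (0 <= G t)%E.
Proof. by apply: adde_ge0; [rewrite lee_fin|apply: mule_ge0; [rewrite lee_fin|exact: sqsum_ge0]]. Qed.

Let mG : measurable_fun I G.
Proof.
by apply: emeasurable_funD; [exact: measurable_cst|apply: measurable_funeM].
Qed.

Let iG : mu.-integrable J G.
Proof.
apply: (@integrableS _ _ R mu I) => //; first exact: mI.
apply: (@integrableD _ _ R mu I mI (cst c1%:E) (fun t => c2%:E * N t)%E).
  exact: (integrable_bounded_unit (u := fun=> c1) (B := `|c1|)).
apply: integrableZl => //; first exact: mI.
apply/integrableP; split=> //.
by under eq_integral do rewrite gee0_abs ?sqsum_ge0//; rewrite intN.
Qed.

(** Otherwise S (1/2)^2 / (1/2 - t) would be dominated near 1/2 by an integrable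
    function, namely an affine function of N. *)
Let S_half : S 2^-1 = 0.
Proof.
apply/eqP; rewrite -sqrf_eq0; apply/eqP.
apply: (inverse_distance_not_integrable (sqr_ge0 _) iG G0).
apply: (ae_lebesgue2 (P := fun=> True) _ _ good_ae); last exact: aeW.
by move=> t _ gt Jt; apply: S_half_bound => //; apply: gt; exact: JI.
Qed.

(** As S vanishes at both ends of the period and is Lipschitz, the singular term
    S^2 / (1/2 - |t|) of the pointwise bound is itself at most a multiple of D^2. *)
Lemma real_sampling_bound : (\int[mu]_x (u x ^+ 2)%:E <= (sampling_const * (3216 * D ^+ 2))%:E)%E.
Proof.
rewrite -intN.
apply: (@le_trans _ _ (\int[mu]_(t in I) (cst (sampling_const * (3216 * D ^+ 2))%:E t))%E); last first.
  by rewrite (@integral_cst _ _ R mu I mI) lebesgue_unit_itv mule1.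
have K0 : 0 <= sampling_const * (3216 * D ^+ 2).
  apply: mulr_ge0; first exact: sampling_const0.
  by apply: mulr_ge0; [exact: ler0n|exact: sqr_ge0].
apply: (@ae_ge0_le_integral _ _ R mu I mI).
- by move=> t _; exact: sqsum_ge0.
- exact: mN.
- by move=> t _; rewrite lee_fin.
- exact: measurable_cst.
apply: (ae_lebesgue2 (P := fun=> True) _ _ good_ae); last exact: aeW.
move=> t _ gt It; have {}gt := gt It; have [t1 _ _] := gt.
have [le1 _] := bounds gt; apply: le_trans le1 _; rewrite /cst lee_fin.
apply: ler_wpM2l; first exact: sampling_const0.
set d := 2^-1 - `|t|; have d0 : 0 < d by rewrite subr_gt0.
have St : `|S t| <= 80 * D * d.
  have [t0|t0] := leP 0 t.
    have td : `|t - 2^-1| = d.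
      by rewrite /d (ger0_norm t0) distrC gtr0_norm// subr_gt0 -(ger0_norm t0).
    by have := S_lipschitz t 2^-1; rewrite S_half subr0 td.
  have Sm : S (- 2^-1) = 0.
    rewrite -[RHS]S_half -(S_periodic 1 (- 2^-1)); congr S.
    by rewrite mulr1z; field.
  have td : `|t - - 2^-1| = d.
    rewrite /d (ltr0_norm t0) !opprK addrC gtr0_norm//.
    by move: t1; rewrite (ltr0_norm t0); lra.
  by have := S_lipschitz t (- 2^-1); rewrite Sm subr0 td.
have d1 : d <= 2^-1 by rewrite lerBlDr lerDl.
have : S t ^+ 2 / d <= 6400 * D ^+ 2 * d.
  rewrite ler_pdivrMr// -real_normK ?num_real//.
  apply: (@le_trans _ _ ((80 * D * d) ^+ 2)).
    by rewrite ler_sqr ?nnegrE//; apply: le_trans (normr_ge0 _) St.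
  by rewrite le_eqVlt; apply/orP; left; apply/eqP; ring.
have : D ^+ 2 * d <= D ^+ 2 * 2^-1 by rewrite ler_wpM2l ?sqr_ge0.
rewrite exprMn; lra.
Qed.

End Function.
End RealSampling.

Local Open Scope complex_scope.
(** * Complex-valued functions and the Gabor system *)

Section Final.
Context {R : realType}.
Local Notation mu := (@lebesgue_measure R).

Lemma cmod_sqr (z : R[i]) : cmod z ^+ 2 = complex.Re z ^+ 2 + complex.Im z ^+ 2.
Proof. by case: z => x y; rewrite /cmod /= sqr_sqrtr// addr_ge0 ?sqr_ge0. Qed.

Lemma cmod_ge0 (z : R[i]) : 0 <= cmod z.
Proof. by case: z => x y; exact: sqrtr_ge0. Qed.

Lemma le_Re_cmod (z : R[i]) : `|complex.Re z| <= cmod z.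
Proof.
rewrite -(@ler_sqr _ `|_|) ?nnegrE ?cmod_ge0// cmod_sqr real_normK ?num_real//.
by rewrite lerDl sqr_ge0.
Qed.

Lemma le_Im_cmod (z : R[i]) : `|complex.Im z| <= cmod z.
Proof.
rewrite -(@ler_sqr _ `|_|) ?nnegrE ?cmod_ge0// cmod_sqr real_normK ?num_real//.
by rewrite lerDr sqr_ge0.
Qed.

Lemma L2norm_sqr (f : R -> R[i]) :
  (L2norm mu f ^+ 2 = \int[mu]_x (complex.Re (f x) ^+ 2 + complex.Im (f x) ^+ 2)%:E)%E.
Proof.
rewrite /L2norm unlock.
have -> : (\int[mu]_x (`|(EFin \o (@cmod R \o f)) x| `^ 2) =
   \int[mu]_x (complex.Re (f x) ^+ 2 + complex.Im (f x) ^+ 2)%:E)%E.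
  apply: eq_integral => x _; rewrite /= ger0_norm ?cmod_ge0// -cmod_sqr.
  by rewrite powR_mulrn ?cmod_ge0.
have i0 : (0 <= \int[mu]_x (complex.Re (f x) ^+ 2 + complex.Im (f x) ^+ 2)%:E)%E.
  by apply: integral_ge0 => x _; rewrite lee_fin addr_ge0 ?sqr_ge0.
by rewrite poweR12_sqrt// sqr_sqrte.
Qed.

Lemma L2norm_lty (f : R -> R[i]) : (L2norm mu f < +oo)%E <->
  (\int[mu]_x (complex.Re (f x) ^+ 2 + complex.Im (f x) ^+ 2)%:E < +oo)%E.
Proof.
rewrite -L2norm_sqr.
have n0 : (0 <= L2norm mu f)%E by rewrite /L2norm unlock poweR_ge0.
move: n0; case: (L2norm mu f) => [r| |] // _; rewrite expe2.
  by rewrite -EFinM !ltry.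
Qed.

Lemma gaborE (m n : int) (t : R) : gabor (@gaussian R) (m, n) t =
  (gaussR (t - m%:~R) * cosZ n t) +i* (gaussR (t - m%:~R) * sinZ n t).
Proof.
rewrite /gabor /gaussian /expi /gaussR /cosZ /sinZ /=.
by apply/eqP; rewrite eq_complex /=; apply/andP; split; apply/eqP; ring.
Qed.

Lemma gabor_L2 (mn : int * int) : L2 mu (gabor (@gaussian R) mn).
Proof.
case: mn => m n; split.
  split.
    under eq_fun do rewrite gaborE /=.
    by apply: measurable_funM; [exact: measurable_gaussR|exact: measurable_cosZ].
  under eq_fun do rewrite gaborE /=.
  by apply: measurable_funM; [exact: measurable_gaussR|exact: measurable_sinZ].
apply/L2norm_lty.
have /integrableP[_] := @integrable_gaussR_sqr R m%:~R.
apply: le_lt_trans; rewrite le_eqVlt; apply/orP; left; apply/eqP.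
apply: eq_integral => x _; rewrite gaborE /= ger0_norm ?sqr_ge0//.
by rewrite !exprMn -mulrDr cos2Dsin2 mulr1.
Qed.

(** Any weight that makes the Fourier coefficients and the translates decay
    geometrically would do; evenness in the modulation index is what allows
    the real and imaginary parts of f to be separated. *)
Definition weight (mn : int * int) : R := 4 ^+ (`|mn.1|%N + `|mn.2|%N).

Lemma weight_gt0 mn : 0 < weight mn.
Proof. by rewrite exprn_gt0. Qed.

Lemma weightN m n : weight (m, - n) = weight (m, n).
Proof. by rewrite /weight /= abszN. Qed.

Definition coef_cos (u : R -> R) (m n : int) : R :=
  \int[mu]_x (u x * gaussR (x - m%:~R) * cosZ n x).
Definition coef_sin (u : R -> R) (m n : int) : R :=
  \int[mu]_x (u x * gaussR (x - m%:~R) * sinZ n x).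

Lemma coef_cosN u m n : coef_cos u m (- n) = coef_cos u m n.
Proof. by apply: eq_Rintegral => x _; rewrite /cosZ mulrNz mulrN mulNr cosN. Qed.

Section Coefficients.
Variable u : R -> R.
Hypotheses (mu_ : measurable_fun setT u) (u2 : (\int[mu]_x (u x ^+ 2)%:E < +oo)%E).

Lemma integrable_coef_cos m n :
  mu.-integrable setT (EFin \o (fun x => u x * gaussR (x - m%:~R) * cosZ n x)).
Proof.
apply: (integrable_mul_bounded (B := 1)) => //; first exact: integrable_gaussR_mul.
  exact: measurable_cosZ.
by move=> t _; exact: cosZ_le1.
Qed.

Lemma integrable_coef_sin m n :
  mu.-integrable setT (EFin \o (fun x => u x * gaussR (x - m%:~R) * sinZ n x)).
Proof.
apply: (integrable_mul_bounded (B := 1)) => //; first exact: integrable_gaussR_mul.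
  exact: measurable_sinZ.
by move=> t _; exact: sinZ_le1.
Qed.

Lemma coef_sinN m n : coef_sin u m (- n) = - coef_sin u m n.
Proof.
have := @RintegralZl _ _ R mu setT _ (-1) measurableT (integrable_coef_sin m n).
rewrite mulN1r => <-; apply: eq_Rintegral => x _.
by rewrite /sinZ mulrNz mulrN mulNr sinN; ring.
Qed.

End Coefficients.

(** Comparing n with - n in this formula isolates the four real coefficients. *)
Lemma inner_gabor (f : R -> R[i]) (U V : R -> R) (m n : int) :
  (forall x, f x = U x +i* V x) ->
  measurable_fun setT U -> measurable_fun setT V ->
  (\int[mu]_x (U x ^+ 2)%:E < +oo)%E -> (\int[mu]_x (V x ^+ 2)%:E < +oo)%E ->
  L2inner mu f (fun x => (weight (m, n))%:C * gabor (@gaussian R) (m, n) x) =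
  (weight (m, n) * (coef_cos U m n + coef_sin V m n)) +i*
  (weight (m, n) * (coef_cos V m n - coef_sin U m n)).
Proof.
move=> fE mU mV U2 V2; rewrite /L2inner /cintegral; set w := weight _.
have [iUc iVc] := (integrable_coef_cos mU U2 m n, integrable_coef_cos mV V2 m n).
have [iUs iVs] := (integrable_coef_sin mU U2 m n, integrable_coef_sin mV V2 m n).
have iZ (g : R -> R) : mu.-integrable setT (EFin \o g) ->
    mu.-integrable setT (EFin \o (fun t => w * g t)).
  by move=> /(@integrableZl _ _ R mu setT measurableT w); congr (_.-integrable _ _); apply/funext.
congr (_ +i* _).
- rewrite mulrDr /coef_cos /coef_sin -!RintegralZl//.
  rewrite -RintegralD//; [|exact: iZ|exact: iZ].
  by apply: eq_Rintegral => x _; rewrite fE gaborE /=; ring.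
- rewrite mulrBr /coef_cos /coef_sin -!RintegralZl//.
  rewrite -RintegralB//; [|exact: iZ|exact: iZ].
  by apply: eq_Rintegral => x _; rewrite fE gaborE /=; ring.
Qed.

Lemma coefs_bound (w x y D : R) : 0 < w -> `|w * (x + y)| <= D -> `|w * (x - y)| <= D ->
  `|x| <= D * w^-1 /\ `|y| <= D * w^-1.
Proof.
move=> w0 h1 h2; split.
- rewrite ler_pdivlMr// mulrC -(gtr0_norm w0) -normrM.
  rewrite (_ : w * x = 2^-1 * (w * (x + y)) + 2^-1 * (w * (x - y))); last by field.
  by apply: le_trans (ler_normD _ _) _; rewrite !normrM !(@ger0_norm _ 2^-1)// -!normrM; lra.
- rewrite ler_pdivlMr// mulrC -(gtr0_norm w0) -normrM.
  rewrite (_ : w * y = 2^-1 * (w * (x + y)) - 2^-1 * (w * (x - y))); last by field.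
  by apply: le_trans (ler_normB _ _) _; rewrite !normrM !(@ger0_norm _ 2^-1)// -!normrM; lra.
Qed.

(** If the sum is finite, with square root D, each term is at most D^2, which is
    the decay of the real coefficients that real_sampling_bound asks for. *)
Lemma gabor_lower_bound (f : R -> R[i]) : L2 mu f ->
  ((2 * (sampling_const * 3216))^-1%:E * L2norm mu f ^+ 2 <=
   \esum_(k in [set: int * int])
     (cmod (L2inner mu f (fun x => (weight k)%:C * gabor (@gaussian R) k x)) ^+ 2)%:E)%E.
Proof.
move=> [[mU mV] /L2norm_lty foo].
pose U x := complex.Re (f x); pose V x := complex.Im (f x).
have fE x : f x = U x +i* V x by rewrite /U /V; case: (f x).
have U0 x : (0 <= (U x ^+ 2)%:E)%E by rewrite lee_fin sqr_ge0.
have V0 x : (0 <= (V x ^+ 2)%:E)%E by rewrite lee_fin sqr_ge0.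
have mU2 : measurable_fun setT (fun x => (U x ^+ 2)%:E).
  by apply/measurable_EFinP; exact: measurable_funX.
have mV2 : measurable_fun setT (fun x => (V x ^+ 2)%:E).
  by apply/measurable_EFinP; exact: measurable_funX.
have UV_split : (\int[mu]_x (complex.Re (f x) ^+ 2 + complex.Im (f x) ^+ 2)%:E =
   \int[mu]_x (U x ^+ 2)%:E + \int[mu]_x (V x ^+ 2)%:E)%E.
  rewrite -(@ge0_integralD _ _ R mu setT)//.
have U2 : (\int[mu]_x (U x ^+ 2)%:E < +oo)%E.
  by apply: le_lt_trans foo; rewrite UV_split leeDl// integral_ge0.
have V2 : (\int[mu]_x (V x ^+ 2)%:E < +oo)%E.
  by apply: le_lt_trans foo; rewrite UV_split leeDr// integral_ge0.
set a := fun k => cmod (L2inner mu f (fun x => (weight k)%:C * gabor (@gaussian R) k x)).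
have a0 k : 0 <= a k by exact: cmod_ge0.
rewrite -/(esumT (fun k => a k ^+ 2)) L2norm_sqr UV_split.
have a20 k : 0 <= a k ^+ 2 by rewrite sqr_ge0.
have [Aoo|] := ltP (esumT (fun k => a k ^+ 2)) +oo%E; last first.
  by rewrite leye_eq => /eqP ->; rewrite leey.
have Afin := esumT_fin_num a20 Aoo.
set D := Num.sqrt (fine (esumT (fun k => a k ^+ 2))).
have D0 : 0 <= D by exact: sqrtr_ge0.
have D2 : D ^+ 2 = fine (esumT (fun k => a k ^+ 2)).
  by rewrite sqr_sqrtr// fine_ge0// esumT_ge0.
have aD k : a k <= D.
  rewrite -(@ler_sqr _ (a k)) ?nnegrE// D2 -lee_fin fineK//.
  exact: (esumT_ge k a20).
have coefs m n : [/\ `|coef_cos U m n| <= D * (weight (m, n))^-1,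
    `|coef_sin U m n| <= D * (weight (m, n))^-1,
    `|coef_cos V m n| <= D * (weight (m, n))^-1 &
    `|coef_sin V m n| <= D * (weight (m, n))^-1].
  have w0 := weight_gt0 (m, n).
  have e1 := inner_gabor m n fE mU mV U2 V2.
  have e2 := inner_gabor m (- n) fE mU mV U2 V2.
  rewrite !coef_cosN !(coef_sinN mU U2) !(coef_sinN mV V2) weightN opprK in e2.
  have r1 := le_trans (le_Re_cmod _) (aD (m, n)).
  have i1 := le_trans (le_Im_cmod _) (aD (m, n)).
  have r2 := le_trans (le_Re_cmod _) (aD (m, - n)).
  have i2 := le_trans (le_Im_cmod _) (aD (m, - n)).
  rewrite e1 /= in r1 i1; rewrite weightN e2 /= in r2 i2.
  have [? ?] := coefs_bound w0 r1 r2.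
  by have [? ?] := coefs_bound w0 i2 i1; split.
have wE m n : (weight (m, n))^-1 = 4^-1 ^+ (`|m|%N + `|n|%N) :> R.
  by rewrite /weight /= exprVn.
have bU := @real_sampling_bound R U D mU U2 D0
  (fun m n => ltac:(by have [+ _ _ _] := coefs m n; rewrite wE))
  (fun m n => ltac:(by have [_ + _ _] := coefs m n; rewrite wE)).
have bV := @real_sampling_bound R V D mV V2 D0
  (fun m n => ltac:(by have [_ _ + _] := coefs m n; rewrite wE))
  (fun m n => ltac:(by have [_ _ _ +] := coefs m n; rewrite wE)).
have B0 : 0 < sampling_const * 3216 :> R.
  by rewrite /sampling_const; apply: mulr_gt0; [apply: mulr_gt0; [exact: ltr0n|exact: expR_gt0]|exact: ltr0n].
rewrite -(fineK Afin) -D2.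
apply: (@le_trans _ _ ((2 * (sampling_const * 3216))^-1%:E *
    ((sampling_const * (3216 * D ^+ 2))%:E + (sampling_const * (3216 * D ^+ 2))%:E))%E).
  apply: lee_wpmul2l; last exact: leeD.
  by rewrite lee_fin invr_ge0; apply: mulr_ge0; [exact: ler0n|exact: ltW].
rewrite -EFinD -EFinM lee_fin le_eqVlt; apply/orP; left; apply/eqP.
move: B0; set B := sampling_const; set q := 3216 => B0.
by field; move: B0; rewrite lt0r mulf_eq0 negb_or => /andP[/andP[-> _]].
Qed.

End Final.

Theorem corollary1p1 (R : realType) :
  weighted_lower_semi_frame (@lebesgue_measure R) (gabor (@gaussian R)).
Proof.
split; first exact: gabor_L2.
exists ((2 * (sampling_const * 3216))^-1), weight; split.
- rewrite invr_gt0; apply: mulr_gt0; first exact: ltr0n.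
  by rewrite /sampling_const; apply: mulr_gt0; [apply: mulr_gt0; [exact: ltr0n|exact: expR_gt0]|exact: ltr0n].
- exact: weight_gt0.
- exact: gabor_lower_bound.
Qed.
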